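(* Let $A$ be an artin $R$-algebra with radical square zero. Then for every $n\in\mathbb{Z}$ the associated $\Gamma(A)$-$\Gamma(A)$-bimodule $K^n(A)$ is invertible, and for all $n,m\in\mathbb{Z}$ the map $\phi^{n,m}\colon K^n(A)\otimes_{\Gamma(A)}K^m(A)\to K^{n+m}(A)$ is an isomorphism of $\Gamma(A)$-$\Gamma(A)$-bimodules.
   Context: $R$ is a commutative artinian ring; an artin $R$-algebra is an $R$-algebra that is finitely generated as an $R$-module. $\mathbf{r}$ denotes the Jacobson radical of $A$. $A$ is with radical square zero if $\mathbf{r}^2=0$; then $\mathbf{r}$ is naturally an $A/\mathbf{r}$-$A/\mathbf{r}$-bimodule. Put $\mathbf{r}^{\otimes 0}=A/\mathbf{r}$ and $\mathbf{r}^{\otimes i+1}=\mathbf{r}\otimes_{A/\mathbf{r}}(\mathbf{r}^{\otimes i})$ for $i\geq 0$. Below, $\mathrm{Hom}_{A/\mathbf{r}}$ and $\mathrm{End}_{A/\mathbf{r}}$ refer to left $A/\mathbf{r}$-modules. The associated regular algebra $\Gamma(A)$ is the direct limit of the chain of algebra homomorphisms $\mathrm{End}_{A/\mathbf{r}}(\mathbf{r}^{\otimes i})\to \mathrm{End}_{A/\mathbf{r}}(\mathbf{r}^{\otimes i+1})$, $i\ge 0$, induced by $\mathbf{r}\otimes_{A/\mathbf{r}}-$. For $n\in\mathbb{Z}$, $K^n(A)$ is the direct limit, over $i\geq \max\{0,n\}$, of the chain of maps $\mathrm{Hom}_{A/\mathbf{r}}(\mathbf{r}^{\otimes i},\mathbf{r}^{\otimes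 i-n})\to \mathrm{Hom}_{A/\mathbf{r}}(\mathbf{r}^{\otimes i+1},\mathbf{r}^{\otimes i+1-n})$ induced by $\mathbf{r}\otimes_{A/\mathbf{r}}-$. The natural $\mathrm{End}_{A/\mathbf{r}}(\mathbf{r}^{\otimes i-n})$-$\mathrm{End}_{A/\mathbf{r}}(\mathbf{r}^{\otimes i})$-bimodule structures (by composition) make $K^n(A)$ a $\Gamma(A)$-$\Gamma(A)$-bimodule. The map $\phi^{n,m}$ is induced by composition: if $f\in K^n(A)$ and $g\in K^m(A)$ are represented, for some large $j$, by $f'\colon \mathbf{r}^{\otimes j-m}\to\mathbf{r}^{\otimes j-m-n}$ and $g'\colon \mathbf{r}^{\otimes j}\to\mathbf{r}^{\otimes j-m}$, then $\phi^{n,m}(f\otimes g)$ is represented by $f'\circ g'$. A $\Gamma$-$\Gamma$-bimodule $K$ over an algebra $\Gamma$ is invertible if the functor $K\otimes_\Gamma-$ is an auto-equivalence of the category of left $\Gamma$-modules (equivalently, $-\otimes_\Gamma K$ is an auto-equivalence of the category of right $\Gamma$-modules). *)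

(* Defs.v *)
From HB Require Import structures.
From mathcomp Require Import all_boot all_algebra.
From mathcomp Require Import boolp.
From mathcomp.multinomials Require Import freeg.

Set Implicit Arguments.
Unset Strict Implicit.
Unset Printing Implicit Defensive.

Import GRing.Theory.
Local Open Scope ring_scope.
Local Open Scope quotient_scope.

(* An R-algebra is a ring with a ring homomorphism from R to its centre; the
   library's algType would exclude the zero algebra. *)
Record algebra_on (R : comPzRingType) (A : pzRingType) := AlgebraOn {
  alg_map :> {rmorphism R -> A};
  alg_central : forall (c : R) (x : A), alg_map c * x = x * alg_map c
}.

HB.mixin Record isRightModule (S : pzRingType) V of GRing.Zmodule V := {
  ract : V -> S -> V;
  ractA : forall v a b, ract (ract v a) b = ract v (a * b);
  ract1 : forall v, ract v 1 = v;
  ractDl : forall u v a, ract (u + v) a = ract u a + ract v a;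
  ractDr : forall v a b, ract v (a + b) = ract v a + ract v b
}.
#[short(type="rmodType")]
HB.structure Definition RightModule (S : pzRingType) :=
  {V of isRightModule S V & GRing.Zmodule V}.

HB.mixin Record isBimodule (L S : pzRingType) V
    of GRing.Lmodule L V & RightModule S V := {
  scale_ract : forall (a : L) (v : V) (b : S),
    a *: ract v b = ract (a *: v) b
}.
#[short(type="bimodType")]
HB.structure Definition Bimodule (L S : pzRingType) :=
  {V of isBimodule L S V & GRing.Lmodule L V & RightModule S V}.

Notation "v <* a" := (ract v a) (at level 40, left associativity) : ring_scope.

Section Tensor.
Variables (S : pzRingType) (M : rmodType S) (N : lmodType S).

Local Notation gen m n := (<< (m, n) >> : {freeg (M * N)%type}).

(* The subgroup of the free abelian group on M x N spanned by the relators. *)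
Inductive tens_rel : {freeg (M * N)%type} -> Prop :=
| TensDl m m' n : tens_rel (gen (m + m') n - gen m n - gen m' n)
| TensDr m n n' : tens_rel (gen m (n + n') - gen m n - gen m n')
| TensMid m a n : tens_rel (gen (m <* a) n - gen m (a *: n))
| Tens0 : tens_rel 0
| TensB x y : tens_rel x -> tens_rel y -> tens_rel (x - y).

Definition tens_null : {pred {freeg (M * N)%type}} := fun x => `[< tens_rel x >].

Fact tens_null_closed : zmod_closed tens_null.
Proof.
split=> [|x y]; first exact/asboolP/Tens0.
by move=> /asboolP hx /asboolP hy; apply/asboolP/TensB.
Qed.
HB.instance Definition _ :=
  GRing.isZmodClosed.Build {freeg (M * N)%type} tens_null tens_null_closed.

Definition tens : Type := Quotient.quot tens_null.
HB.instance Definition _ := GRing.Zmodule.on tens.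

Definition tmk (m : M) (n : N) : tens := \pi_(Quotient.quot tens_null) (gen m n).

End Tensor.

Notation "m ⊗ n" := (tmk m n) (at level 40, left associativity) : ring_scope.

Definition balanced (S : pzRingType) (M : rmodType S) (N : lmodType S)
    (G : zmodType) (f : M -> N -> G) : Prop :=
  [/\ forall m m' n, f (m + m') n = f m n + f m' n,
      forall m n n', f m (n + n') = f m n + f m n'
    & forall m a n, f (m <* a) n = f m (a *: n)].

(* The additive map on M ⊗ N induced by f, when f is balanced (tens_liftE). *)
Definition tens_lift (S : pzRingType) (M : rmodType S) (N : lmodType S)
    (G : zmodType) (f : M -> N -> G) (x : tens M N) : G :=
  fglift (fun p => f p.1 p.2 : zmodule G) (repr x).

Section TensorTheory.
Variables (S : pzRingType) (M : rmodType S) (N : lmodType S).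
Implicit Types (m : M) (n : N).
Local Notation gen m n := (<< (m, n) >> : {freeg (M * N)%type}).

Local Notation pi_tens := (\pi_(Quotient.quot (@tens_null S M N))).

Let Qind (P : tens M N -> Prop) : (forall x, P (pi_tens x)) -> forall x, P x.
Proof. by move=> h x; rewrite -[x](@reprK _ (Quotient.quot (@tens_null S M N))). Qed.

Lemma tmk_balanced : balanced (@tmk S M N).
Proof.
have eqP0 (x y : {freeg (M * N)%type}) : tens_rel (x - y) ->
    \pi_(Quotient.quot (@tens_null S M N)) x = \pi_(Quotient.quot (@tens_null S M N)) y.
  by move=> h; apply/eqP; rewrite -Quotient.idealrBE; apply/asboolP.
split=> [m m' n|m n n'|m a n].
- rewrite /tmk -raddfD; apply: eqP0; rewrite opprD addrA; exact: TensDl.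
- rewrite /tmk -raddfD; apply: eqP0; rewrite opprD addrA; exact: TensDr.
- apply: eqP0; exact: TensMid.
Qed.

Lemma tmkDl m m' n : (m + m') ⊗ n = m ⊗ n + m' ⊗ n.
Proof. by case: tmk_balanced. Qed.
Lemma tmkDr m n n' : m ⊗ (n + n') = m ⊗ n + m ⊗ n'.
Proof. by case: tmk_balanced. Qed.
Lemma tmk_mid m a n : (m <* a) ⊗ n = m ⊗ (a *: n).
Proof. by case: tmk_balanced. Qed.

Lemma tens_ind (P : tens M N -> Prop) :
  (forall m n, P (m ⊗ n)) -> (forall x y, P x -> P y -> P (x - y)) ->
  forall x, P x.
Proof.
move=> Pg PB; have P0 : P 0 by rewrite -(subrr (0 ⊗ 0)); apply: PB.
have PN x : P x -> P (- x) by move=> hx; rewrite -sub0r; apply: PB.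
have PD x y : P x -> P y -> P (x + y).
  by move=> hx hy; rewrite -[y]opprK; apply/PB/PN.
have Pn x k : P x -> P (x *+ k).
  by move=> hx; elim: k => [|k ih]; rewrite ?mulr0n // mulrS; apply: PD.
apply: Qind; apply: (@freeg_ind_dom0 int _ (fun x => P (pi_tens x))).
  by rewrite raddf0.
move=> k [m n] D _ _ ih.
rewrite raddfD /=; apply: PD => //.
have -> : << k *g (m, n) >> = (gen m n) *~ k by rewrite freegU_mulz intz.
rewrite raddfMz; case: k => k; first by apply: Pn; apply: Pg.
by rewrite NegzE mulrNz; apply: PN; apply: Pn; apply: Pg.
Qed.

Section Lift.
Variables (G : zmodType) (f : M -> N -> G).
Hypothesis fP : balanced f.

Let fl : {freeg (M * N)%type} -> G := fglift (fun p => f p.1 p.2 : zmodule G).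

Let flB : zmod_morphism fl.
Proof. exact: (@lift_is_additive int _ (zmodule G)). Qed.

Let fl0 : fl 0 = 0.
Proof. by have := flB 0 0; rewrite !subrr. Qed.

Let fl_gen m n : fl (gen m n) = f m n.
Proof. by rewrite /fl liftU scale1r. Qed.

Let fl_rel x : tens_rel x -> fl x = 0.
Proof.
case: fP => fDl fDr fm.
elim=> [m m' n|m n n'|m a n||y z _ hy _ hz]; rewrite ?flB ?fl0 ?fl_gen //=.
- by rewrite fDl addrAC addrK subrr.
- by rewrite fDr addrAC addrK subrr.
- by rewrite fm subrr.
- by rewrite hy hz subrr.
Qed.

Let tens_lift_pi x : tens_lift f (\pi_(Quotient.quot (@tens_null S M N)) x) = fl x.
Proof.
apply/eqP; rewrite -subr_eq0 -[tens_lift _ _]/(fl _) -flB; apply/eqP/fl_rel.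
have : repr (pi_tens x) - x \in @tens_null S M N.
  by rewrite Quotient.idealrBE reprK.
by move/asboolP.
Qed.

Lemma tens_liftE m n : tens_lift f (m ⊗ n) = f m n.
Proof. by rewrite tens_lift_pi fl_gen. Qed.

Lemma tens_lift_is_additive : zmod_morphism (tens_lift f).
Proof.
by apply: Qind => x; apply: Qind => y; rewrite -raddfB !tens_lift_pi flB.
Qed.

End Lift.

Lemma tens_ext (G : zmodType) (f g : tens M N -> G) :
  zmod_morphism f -> zmod_morphism g -> (forall m n, f (m ⊗ n) = g (m ⊗ n)) ->
  f =1 g.
Proof.
by move=> fB gB e; elim/tens_ind => // x y hx hy; rewrite fB gB hx hy.
Qed.

End TensorTheory.

Section TensorLeftModule.
Variables (L S : pzRingType) (M : bimodType L S) (N : lmodType S).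

Definition tens_scale (a : L) : tens M N -> tens M N :=
  tens_lift (fun m n => (a *: m) ⊗ n).

Fact tens_scale_balanced a : balanced (fun (m : M) (n : N) => (a *: m) ⊗ n).
Proof.
split=> [m m' n|m n n'|m b n]; first by rewrite scalerDr tmkDl.
  exact: tmkDr.
by rewrite scale_ract tmk_mid.
Qed.

Lemma tens_scaleE a (m : M) (n : N) : tens_scale a (m ⊗ n) = (a *: m) ⊗ n.
Proof. exact: tens_liftE (tens_scale_balanced a) m n. Qed.

Fact tens_scaleB a : zmod_morphism (tens_scale a).
Proof. exact: tens_lift_is_additive (tens_scale_balanced a). Qed.

Fact tens_scaleA a b v : tens_scale a (tens_scale b v) = tens_scale (a * b) v.
Proof.
elim/tens_ind: v => [m n|x y hx hy]; first by rewrite !tens_scaleE scalerA.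
by rewrite !tens_scaleB hx hy.
Qed.

Fact tens_scale1 : left_id 1 tens_scale.
Proof.
elim/tens_ind => [m n|x y hx hy]; first by rewrite tens_scaleE scale1r.
by rewrite tens_scaleB hx hy.
Qed.

Fact tens_scaleDr : right_distributive tens_scale +%R.
Proof.
move=> a x y; rewrite -[in LHS](opprK y) tens_scaleB; congr (_ + _).
have h0 : tens_scale a 0 = 0 by have := tens_scaleB a 0 0; rewrite !subrr.
by rewrite -[- y]sub0r tens_scaleB h0 sub0r opprK.
Qed.

Fact tens_scaleDl v : {morph tens_scale^~ v : a b / a + b}.
Proof.
move=> a b; elim/tens_ind: v => [m n|x y hx hy].
  by rewrite !tens_scaleE scalerDl tmkDl.
by rewrite !tens_scaleB hx hy opprD addrACA.
Qed.

HB.instance Definition _ := GRing.Zmodule_isLmodule.Build L (tens M N)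
  tens_scaleA tens_scale1 tens_scaleDr tens_scaleDl.

Lemma scale_tmk a (m : M) (n : N) : a *: (m ⊗ n) = (a *: m) ⊗ n.
Proof. exact: tens_scaleE. Qed.

End TensorLeftModule.

Section TensorRightModule.
Variables (S T : pzRingType) (M : rmodType S) (N : bimodType S T).

Definition tens_ract (x : tens M N) (b : T) : tens M N :=
  tens_lift (fun m n => m ⊗ (n <* b)) x.

Fact tens_ract_balanced b : balanced (fun (m : M) (n : N) => m ⊗ (n <* b)).
Proof.
split=> [m m' n|m n n'|m a n]; first exact: tmkDl.
  by rewrite ractDl tmkDr.
by rewrite -scale_ract tmk_mid.
Qed.

Fact tens_ractE (m : M) (n : N) b : tens_ract (m ⊗ n) b = m ⊗ (n <* b).
Proof. exact: tens_liftE (tens_ract_balanced b) m n. Qed.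

Fact tens_ractB x y b : tens_ract (x - y) b = tens_ract x b - tens_ract y b.
Proof. exact: (tens_lift_is_additive (tens_ract_balanced b)). Qed.

Fact tens_ractA x a b : tens_ract (tens_ract x a) b = tens_ract x (a * b).
Proof.
elim/tens_ind: x => [m n|x y hx hy]; first by rewrite !tens_ractE ractA.
by rewrite !tens_ractB hx hy.
Qed.

Fact tens_ract1 x : tens_ract x 1 = x.
Proof.
elim/tens_ind: x => [m n|x y hx hy]; first by rewrite tens_ractE ract1.
by rewrite tens_ractB hx hy.
Qed.

Fact tens_ractDl x y a : tens_ract (x + y) a = tens_ract x a + tens_ract y a.
Proof.
rewrite -[in LHS](opprK y) tens_ractB; congr (_ + _).
have h0 : tens_ract 0 a = 0 by have := tens_ractB 0 0 a; rewrite !subrr.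
by rewrite -[- y]sub0r tens_ractB h0 sub0r opprK.
Qed.

Fact tens_ractDr x a b : tens_ract x (a + b) = tens_ract x a + tens_ract x b.
Proof.
elim/tens_ind: x => [m n|x y hx hy]; first by rewrite !tens_ractE ractDr tmkDr.
by rewrite !tens_ractB hx hy opprD addrACA.
Qed.

HB.instance Definition _ := isRightModule.Build T (tens M N)
  tens_ractA tens_ract1 tens_ractDl tens_ractDr.

Lemma ract_tmk (m : M) (n : N) b : (m ⊗ n) <* b = m ⊗ (n <* b).
Proof. exact: tens_ractE. Qed.

End TensorRightModule.

Section TensorBimodule.
Variables (L S T : pzRingType) (M : bimodType L S) (N : bimodType S T).

Fact tens_scale_ract (a : L) (x : tens M N) (b : T) :
  a *: (x <* b) = (a *: x) <* b.
Proof.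
elim/tens_ind: x => [m n|x y hx hy]; first by rewrite !(ract_tmk, scale_tmk).
have ractB u v : (u - v : tens M N) <* b = u <* b - v <* b.
  exact: tens_ractB.
by rewrite ractB !scalerBr ractB hx hy.
Qed.

HB.instance Definition _ := isBimodule.Build L T (tens M N) tens_scale_ract.

End TensorBimodule.

Section TensorMap.
Variables (L S : pzRingType) (M : bimodType L S).
Variables (N N' : lmodType S) (f : {linear N -> N'}).

Definition tens_map : tens M N -> tens M N' := tens_lift (fun m n => m ⊗ f n).

Fact tens_map_balanced : balanced (fun (m : M) (n : N) => m ⊗ f n).
Proof.
split=> [m m' n|m n n'|m a n]; first exact: tmkDl.
  by rewrite raddfD tmkDr.
by rewrite tmk_mid linearZ.
Qed.

Lemma tens_mapE (m : M) (n : N) : tens_map (m ⊗ n) = m ⊗ f n.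
Proof. exact: tens_liftE tens_map_balanced m n. Qed.

Fact tens_map_is_additive : zmod_morphism tens_map.
Proof. exact: tens_lift_is_additive tens_map_balanced. Qed.

HB.instance Definition _ :=
  GRing.isZmodMorphism.Build (tens M N) (tens M N') tens_map tens_map_is_additive.

Fact tens_map_is_scalable : scalable tens_map.
Proof.
move=> a; elim/tens_ind => [m n|x y hx hy].
  by rewrite scale_tmk !tens_mapE scale_tmk.
by rewrite scalerBr !tens_map_is_additive hx hy scalerBr.
Qed.

HB.instance Definition _ :=
  GRing.isScalable.Build L (tens M N) (tens M N') *:%R tens_map
    tens_map_is_scalable.

End TensorMap.
Arguments tens_map {L S} M {N N'} f.

Lemma linear_ext (S : pzRingType) (M N : lmodType S) (f g : {linear M -> N}) :
  f =1 g -> f = g.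
Proof.
case: f => f [[cf] [sf]]; case: g => g [[cg] [sg]] /= /funext e; subst g.
by rewrite (Prop_irrelevance cf cg) (Prop_irrelevance sf sg).
Qed.

Section DirectLimit.
Variables (S : pzRingType) (B : bimodType S S).

(* tpow i is the i-th tensor power of B over S, as a left S-module. *)
Fixpoint tpow (i : nat) : lmodType S :=
  if i is i'.+1 then tens B (tpow i') else S^o.

Local Notation hom i j := {linear tpow i -> tpow j}.

(* The map B ⊗ - on Hom(B^⊗i, B^⊗j). *)
Definition tstep i j (f : hom i j) : hom i.+1 j.+1 := tens_map B f.

(* K n is the direct limit of Hom(B^⊗i, B^⊗(i-n)), i >= max(0, n), along tstep:
   the disjoint union (krep n) of its terms, modulo becoming equal after
   finitely many transition maps (krel).  A term is indexed by the pair
   (i, j) of naturals with i - j = n; this avoids truncated subtraction and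
   encodes i >= max(0, n). *)
Record krep (n : int) := KRep {
  ksrc : nat;
  ktgt : nat;
  kmap : hom ksrc ktgt;
  kdeg : ksrc%:Z - ktgt%:Z = n
}.

Fact KRep_irr n i j (f : hom i j) (e e' : i%:Z - j%:Z = n) :
  KRep f e = KRep f e'.
Proof. by rewrite (Prop_irrelevance e e'). Qed.

HB.instance Definition _ n := gen_eqMixin (krep n).
HB.instance Definition _ n := gen_choiceMixin (krep n).

Fact kstep_deg i j n : i%:Z - j%:Z = n -> i.+1%:Z - j.+1%:Z = n.
Proof. by move=> <-; rewrite !intS opprD addrACA subrr add0r. Qed.

Definition kstep n (x : krep n) : krep n :=
  KRep (tstep (kmap x)) (kstep_deg (kdeg x)).

Definition krel n : rel (krep n) :=
  fun x y => `[< exists p q, iter p (@kstep n) x = iter q (@kstep n) y >].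

Fact krel_is_equiv n : equiv_class_of (@krel n).
Proof.
split=> [x|x y|y x z].
- by apply/asboolP; exists 0, 0.
- by apply/asboolP/asboolP => -[p [q e]]; exists q, p.
- move=> /asboolP[p [q e]] /asboolP[p' [q' e']]; apply/asboolP.
  exists (p' + p)%N, (q + q')%N.
  by rewrite !iterD e -iterD addnC iterD e' -!iterD.
Qed.

Canonical krel_equiv n := EquivRelPack (krel_is_equiv n).

Definition K (n : int) : Type := {eq_quot (@krel n)}.
HB.instance Definition _ n := Choice.on (K n).

Definition kcl n i j (e : i%:Z - j%:Z = n) (f : hom i j) : K n :=
  \pi_({eq_quot (@krel n)}) (KRep f e).

Fixpoint push p i j (f : hom i j) : hom (p + i) (p + j) :=
  if p is p'.+1 then tstep (push p' f) else f.

Fact push_deg p i j n : i%:Z - j%:Z = n -> (p + i)%N%:Z - (p + j)%N%:Z = n.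
Proof. by move=> <-; rewrite !PoszD opprD addrACA subrr add0r. Qed.

Lemma iter_kstep n p i j (e : i%:Z - j%:Z = n) (f : hom i j) :
  iter p (@kstep n) (KRep f e) = KRep (push p f) (push_deg p e).
Proof.
elim: p => [|p ih] /=; first exact: KRep_irr.
by rewrite ih /kstep /=; exact: KRep_irr.
Qed.

Lemma kcl_eq n i j i' j' (e : i%:Z - j%:Z = n) (e' : i'%:Z - j'%:Z = n) f f' :
  kcl e f = kcl e' f' <->
  exists p q, iter p (@kstep n) (KRep f e) = iter q (@kstep n) (KRep f' e').
Proof.
split=> [/eqP|h]; last by apply/eqP; rewrite /kcl eqmodE; apply/asboolP.
by rewrite /kcl eqmodE => /asboolP.
Qed.

Lemma kcl_push n p i j (e : i%:Z - j%:Z = n) (e' : (p + i)%N%:Z - (p + j)%N%:Z = n)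
  (f : hom i j) : kcl e' (push p f) = kcl e f.
Proof.
apply/kcl_eq; exists 0, p.
by rewrite (iter_kstep p) /=; exact: KRep_irr.
Qed.

Lemma kcl_step n i j (e : i%:Z - j%:Z = n) (e' : i.+1%:Z - j.+1%:Z = n)
  (f : hom i j) : kcl e' (tstep f) = kcl e f.
Proof. by apply/kcl_eq; exists 0, 1; apply: KRep_irr. Qed.

Lemma KRep_inj n i j (e e' : i%:Z - j%:Z = n) (f f' : hom i j) :
  KRep f e = KRep f' e' -> f = f'.
Proof.
pose cast i1 i2 j1 j2 (p : i1 = i2) (q : j1 = j2) (g : hom i1 j1) : hom i2 j2 :=
  ecast i0 (hom i0 j2) p (ecast j0 (hom i1 j0) q g).
have castP (x y : krep n) : x = y -> forall p q,
    cast (ksrc x) (ksrc y) (ktgt x) (ktgt y) p q (kmap x) = kmap y.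
  by move=> -> p q; rewrite /cast !eq_axiomK.
by move/castP/(_ erefl erefl).
Qed.

Lemma kcl_eqP n i j (e : i%:Z - j%:Z = n) (f f' : hom i j) :
  kcl e f = kcl e f' <-> exists p, push p f = push p f'.
Proof.
split=> [/kcl_eq[p [q]]|[p h]].
  rewrite !iter_kstep => h; exists p.
  have epq : p = q.
    by apply/eqP; rewrite -(eqn_add2r i) -[X in X == _]/(ksrc (KRep (push p f) (push_deg p e))) h.
  by subst q; apply: KRep_inj h.
apply/kcl_eq; exists p, p; rewrite !iter_kstep h //.
Qed.

(* Every element is represented at all sufficiently late stages. *)
Lemma kcl_stage n (x : K n) : exists N : nat,
  forall i j (e : i%:Z - j%:Z = n), (N <= i)%N -> exists f, x = kcl e f.
Proof.
rewrite -[x]reprK; case: (repr x) => i0 j0 f0 e0; exists i0 => i j e hi.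
have [p ei] : exists p, i = (p + i0)%N by exists (i - i0)%N; rewrite subnK.
subst i; have ej : j = (p + j0)%N.
  apply/eqP; rewrite -eqz_nat -(inj_eq (@oppr_inj _)).
  rewrite -(inj_eq (@addrI _ (p + i0)%N%:Z)) e; apply/eqP.
  by rewrite (push_deg p e0).
by subst j; exists (push p f0); rewrite (kcl_push e0 e f0).
Qed.

Lemma deg_tgt n N : exists i j : nat, [/\ i%:Z - j%:Z = n, (N <= i)%N & (N <= j)%N].
Proof.
case: n => n; first by exists (N + n)%N, N; rewrite leq_addr PoszD addrAC subrr add0r.
exists N, (N + n.+1)%N; rewrite leq_addr NegzE PoszD opprD addrA subrr add0r; split=> //.
Qed.

Lemma push_add p i j (f g : hom i j) : push p (f \+ g) = (push p f \+ push p g) :> hom _ _.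
Proof.
elim: p => [|p ih] /=; apply: linear_ext => // x.
rewrite ih; apply: (tens_ext (f := tens_map B _) (g := fun x => _ x + _ x)) x.
- exact: raddfB.
- by move=> x y /=; rewrite !raddfB opprD addrACA.
- by move=> m v /=; rewrite !tens_mapE tmkDr.
Qed.

Lemma push_opp p i j (f : hom i j) : push p (\- f) = (\- (push p f)) :> hom _ _.
Proof.
elim: p => [|p ih] /=; apply: linear_ext => // x.
rewrite ih; apply: (tens_ext (f := tens_map B _) (g := fun x => - _ x)) x.
- exact: raddfB.
- by move=> x y /=; rewrite !raddfB.
- move=> m v /=; rewrite !tens_mapE.
  by apply/eqP; rewrite -addr_eq0 -tmkDr addNr; have := tmkDr m 0 (0 : tpow (p+j)); rewrite addr0 -[X in X = _]addr0 => /addrI <-.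
Qed.

Lemma push_comp p i j k (f : hom j k) (g : hom i j) :
  push p (f \o g) = (push p f \o push p g) :> hom _ _.
Proof.
elim: p => [|p ih] /=; apply: linear_ext => // x.
rewrite ih; apply: (tens_ext (f := tens_map B _) (g := fun x => _ (_ x))) x.
- exact: raddfB.
- by move=> x y /=; rewrite !raddfB.
- by move=> m v /=; rewrite !tens_mapE.
Qed.

Lemma push_id p i : push p (idfun : hom i i) = (idfun : hom _ _).
Proof.
elim: p => [|p ih] /=; apply: linear_ext => // x.
rewrite ih; apply: (tens_ext (f := tens_map B _) (g := fun x => x)) x => //.
- exact: raddfB.
- by move=> m v /=; rewrite !tens_mapE.
Qed.

Definition kadd_spec n (x y z : K n) : Prop :=
  exists i j (e : i%:Z - j%:Z = n) (f g : hom i j),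
    [/\ x = kcl e f, y = kcl e g & z = kcl e (f \+ g)].

Fact kadd_ex n (x y : K n) : exists z, kadd_spec x y z.
Proof.
have [N1 h1] := kcl_stage x; have [N2 h2] := kcl_stage y.
have [i [j [e hi _]]] := deg_tgt n (maxn N1 N2).
move: hi; rewrite geq_max => /andP[hi1 hi2].
have [f ef] := h1 i j e hi1; have [g eg] := h2 i j e hi2.
by exists (kcl e (f \+ g)), i, j, e, f, g.
Qed.

Lemma push_leq p q i j (f f' : hom i j) : (p <= q)%N ->
  push p f = push p f' -> push q f = push q f'.
Proof.
move=> /subnK <-; elim: (q - p)%N => [|r ih] h //=.
by rewrite ih.
Qed.

(* Two late enough stages on the same antidiagonal differ by a push. *)
Lemma deg_shift n i j i' j' : i%:Z - j%:Z = n -> i'%:Z - j'%:Z = n ->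
  (i <= i')%N -> exists2 p, i' = (p + i)%N & j' = (p + j)%N.
Proof.
move=> e e' le_ii'; have ei : i' = (i' - i + i)%N by rewrite subnK.
exists (i' - i)%N => //; apply/eqP; rewrite -eqz_nat -(inj_eq (@oppr_inj _)).
rewrite -(inj_eq (@addrI _ i'%:Z)) e'; apply/eqP.
by rewrite [X in X%:Z - _]ei (push_deg _ e).
Qed.

Fact kadd_uniq n (x y z z' : K n) : kadd_spec x y z -> kadd_spec x y z' -> z = z'.
Proof.
move=> [i [j [e [f [g [-> -> ->]]]]]] [i' [j' [e' [f' [g' [ef eg ->]]]]]].
wlog le_ii' : i j e f g i' j' e' f' g' ef eg / (i <= i')%N.
  move=> h; case: (leqP i i') => [|/ltnW] h'; first exact: h.
  by apply/esym/h.
have [p ei ej] := deg_shift e e' le_ii'; subst i' j'; move: ef eg.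
rewrite -(kcl_push e e' f) -(kcl_push e e' g) -(kcl_push e e' (f \+ g)).
move=> /kcl_eqP[p1 h1] /kcl_eqP[p2 h2].
apply/kcl_eqP; exists (maxn p1 p2).
rewrite (push_add p) !push_add; apply: linear_ext => v /=.
by rewrite (push_leq (leq_maxl p1 p2) h1) (push_leq (leq_maxr p1 p2) h2).
Qed.

(* The sum of x and y is the class of f + g for any representatives f and g
   lying in the same term (kaddE). *)
Definition kadd n (x y : K n) : K n := projT1 (cid (kadd_ex x y)).

Lemma kaddE n i j (e : i%:Z - j%:Z = n) (f g : hom i j) :
  kadd (kcl e f) (kcl e g) = kcl e (f \+ g).
Proof.
rewrite /kadd; case: cid => z /= /kadd_uniq; apply.
by exists i, j, e, f, g.
Qed.

Definition kopp n (x : K n) : K n :=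
  kcl (kdeg (repr x)) (\- (kmap (repr x))).

Lemma koppE n i j (e : i%:Z - j%:Z = n) (f : hom i j) :
  kopp (kcl e f) = kcl e (\- f).
Proof.
rewrite /kopp; case: (repr (kcl e f)) (reprK (kcl e f)) => i' j' f' e' /=.
rewrite -[\pi _]/(kcl e' f').
wlog le_ii' : i j e f i' j' e' f' / (i <= i')%N.
  move=> h; case: (leqP i i') => [|/ltnW] h' ef; first exact: h.
  by apply/esym/h.
have [p ei ej] := deg_shift e e' le_ii'; subst i' j'.
rewrite -(kcl_push e e' f) -(kcl_push e e' (\- f)) => /kcl_eqP[q h].
by apply/kcl_eqP; exists q; rewrite (push_opp p) !push_opp h.
Qed.

Fact zero_deg (n : int) :
  (if n is Posz k then k else 0%N)%:Z - (if n is Negz k then k.+1 else 0%N)%:Z = n.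
Proof. by case: n => k; rewrite ?subr0 // sub0r NegzE. Qed.

Definition kzero n : K n := kcl (zero_deg n) \0.

Lemma push0 p i j : push p (\0 : hom i j) = (\0 : hom _ _).
Proof.
elim: p => [|p ih] /=; apply: linear_ext => // x.
rewrite ih; apply: (tens_ext (f := tens_map B _) (g := fun x => 0)) x.
- exact: raddfB.
- by move=> x y /=; rewrite subrr.
- move=> m v /=; rewrite tens_mapE /=.
  by have := tmkDr m 0 (0 : tpow (p+j)); rewrite addr0 -[X in X = _]addr0 => /addrI <-.
Qed.

Lemma kcl0 n i j i' j' (e : i%:Z - j%:Z = n) (e' : i'%:Z - j'%:Z = n) :
  kcl e \0 = kcl e' \0.
Proof.
wlog le_ii' : i j e i' j' e' / (i <= i')%N.
  move=> h; case: (leqP i i') => [|/ltnW] h'; first exact: h.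
  exact/esym/h.
have [p ei ej] := deg_shift e e' le_ii'; subst i' j'.
by rewrite -(kcl_push e e' \0) push0.
Qed.

Lemma kzeroE n i j (e : i%:Z - j%:Z = n) : kcl e \0 = kzero n.
Proof. exact: kcl0. Qed.

Lemma kcl_stage3 n (x y z : K n) : exists i j (e : i%:Z - j%:Z = n) f g h,
  [/\ x = kcl e f, y = kcl e g & z = kcl e h].
Proof.
have [N1 h1] := kcl_stage x; have [N2 h2] := kcl_stage y.
have [N3 h3] := kcl_stage z.
have [i [j [e hi _]]] := deg_tgt n (maxn N1 (maxn N2 N3)).
move: hi; rewrite !geq_max => /and3P[hi1 hi2 hi3].
have [f ef] := h1 i j e hi1; have [g eg] := h2 i j e hi2.
have [h eh] := h3 i j e hi3.
by exists i, j, e, f, g, h.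
Qed.

Fact kaddA n : associative (@kadd n).
Proof.
move=> x y z; have [i [j [e [f [g [h [-> -> ->]]]]]]] := kcl_stage3 x y z.
by rewrite !kaddE; congr kcl; apply: linear_ext => v /=; rewrite addrA.
Qed.

Fact kaddC n : commutative (@kadd n).
Proof.
move=> x y; have [i [j [e [f [g [_ [-> -> _]]]]]]] := kcl_stage3 x y x.
by rewrite !kaddE; congr kcl; apply: linear_ext => v /=; rewrite addrC.
Qed.

Fact kadd0 n : left_id (kzero n) (@kadd n).
Proof.
move=> x; have [i [j [e [f [_ [_ [-> _ _]]]]]]] := kcl_stage3 x x x.
rewrite -(kzeroE e) kaddE; congr kcl.
by apply: linear_ext => v /=; rewrite add0r.
Qed.

Fact kaddN n : left_inverse (kzero n) (@kopp n) (@kadd n).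
Proof.
move=> x; have [i [j [e [f [_ [_ [-> _ _]]]]]]] := kcl_stage3 x x x.
rewrite koppE -(kzeroE e) kaddE; congr kcl.
by apply: linear_ext => v /=; rewrite addNr.
Qed.

HB.instance Definition _ n :=
  GRing.isZmodule.Build (K n) (@kaddA n) (@kaddC n) (@kadd0 n) (@kaddN n).

Lemma kclD n i j (e : i%:Z - j%:Z = n) (f g : hom i j) :
  kcl e (f \+ g) = kcl e f + kcl e g.
Proof. by rewrite -kaddE. Qed.

Definition kmul_spec (n m l : int) (x : K n) (y : K m) (z : K l) : Prop :=
  exists i j k (e1 : i%:Z - j%:Z = m) (e2 : j%:Z - k%:Z = n)
    (e3 : i%:Z - k%:Z = l) (f : hom j k) (g : hom i j),
    [/\ x = kcl e2 f, y = kcl e1 g & z = kcl e3 (f \o g)].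

Lemma deg_comp (n m l : int) i j k : n + m = l ->
  i%:Z - j%:Z = m -> j%:Z - k%:Z = n -> i%:Z - k%:Z = l.
Proof. by move=> <- <- <-; rewrite [RHS]addrC addrA subrK. Qed.

Fact kmul_ex n m l (e : n + m = l) (x : K n) (y : K m) :
  exists z : K l, kmul_spec x y z.
Proof.
have [N1 h1] := kcl_stage x; have [N2 h2] := kcl_stage y.
have [j0 [k0 [e0 hj hk]]] := deg_tgt n N1.
have [i [j [e1 hi hj']]] := deg_tgt m (maxn N2 j0).
have [k e2] : exists k : nat, j%:Z - k%:Z = n.
  move: hj'; rewrite geq_max => /andP[_ le_j]; exists (j - j0 + k0)%N.
  by rewrite -[X in X%:Z - _](subnK le_j) (push_deg (j - j0) e0).
move: hi hj'; rewrite !geq_max => /andP[hi _] /andP[_ hj'].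
have [f ef] := h1 j k e2 (leq_trans hj hj').
have [g eg] := h2 i j e1 hi.
by exists (kcl (deg_comp e e1 e2) (f \o g)), i, j, k, e1, e2, (deg_comp e e1 e2), f, g.
Qed.

Fact kmul_uniq n m l (x : K n) (y : K m) (z z' : K l) :
  kmul_spec x y z -> kmul_spec x y z' -> z = z'.
Proof.
move=> [i [j [k [e1 [e2 [e3 [f [g [-> -> ->]]]]]]]]].
move=> [i' [j' [k' [e1' [e2' [e3' [f' [g' [ef eg ->]]]]]]]]].
wlog le_ii' : i j k e1 e2 e3 f g i' j' k' e1' e2' e3' f' g' ef eg / (i <= i')%N.
  move=> h; case: (leqP i i') => [|/ltnW] h'.
    exact: (h _ _ _ _ _ _ _ _ _ _ _ _ _ _ _ _ ef eg).
  exact: (esym (h _ _ _ _ _ _ _ _ _ _ _ _ _ _ _ _ (esym ef) (esym eg) _)).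
have [p ei ej] := deg_shift e1 e1' le_ii'; subst i' j'.
have [q eq ek] := deg_shift e2 e2' (leq_addl p j).
have eqp : q = p by apply/eqP; rewrite -(eqn_add2r j) eq.
subst q k'; move: ef eg.
rewrite -(kcl_push e2 e2' f) -(kcl_push e1 e1' g) -(kcl_push e3 e3' (f \o g)).
move=> /kcl_eqP[p1 h1] /kcl_eqP[p2 h2].
apply/kcl_eqP; exists (maxn p1 p2).
rewrite (push_comp p) !push_comp; apply: linear_ext => v /=.
by rewrite (push_leq (leq_maxl p1 p2) h1) (push_leq (leq_maxr p1 p2) h2).
Qed.

(* The product K n x K m -> K (n + m) sends the classes of f and g to that of
   f o g whenever the target of g is the source of f (kmulE).  The index
   l = n + m is kept free because 0 + n, n + 0 and n are not convertible. *)
Definition kmul n m l (e : n + m = l) (x : K n) (y : K m) : K l :=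
  projT1 (cid (kmul_ex e x y)).

Lemma kmulE n m l (e : n + m = l) i j k (e1 : i%:Z - j%:Z = m)
    (e2 : j%:Z - k%:Z = n) (e3 : i%:Z - k%:Z = l) (f : hom j k) (g : hom i j) :
  kmul e (kcl e2 f) (kcl e1 g) = kcl e3 (f \o g).
Proof.
rewrite /kmul; case: cid => z /= /kmul_uniq; apply.
by exists i, j, k, e1, e2, e3, f, g.
Qed.

(* Stages at which two elements of K n, two of K m and two of K r compose. *)
Lemma kcl_chain n m r (x x' : K n) (y y' : K m) (z z' : K r) :
  exists i j k l (e1 : i%:Z - j%:Z = r) (e2 : j%:Z - k%:Z = m)
    (e3 : k%:Z - l%:Z = n) f f' g g' h h',
  [/\ x = kcl e3 f /\ x' = kcl e3 f', y = kcl e2 g /\ y' = kcl e2 g'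
    & z = kcl e1 h /\ z' = kcl e1 h'].
Proof.
have [N1 h1] := kcl_stage x; have [N1' h1'] := kcl_stage x'.
have [N2 h2] := kcl_stage y; have [N2' h2'] := kcl_stage y'.
have [N3 h3] := kcl_stage z; have [N3' h3'] := kcl_stage z'.
have [k0 [l0 [e30 hk0 _]]] := deg_tgt n (maxn N1 N1').
have [j0 [k1 [e20 hj0 hk1]]] := deg_tgt m (maxn k0 (maxn N2 N2')).
have [i [j [e1 hi hj]]] := deg_tgt r (maxn j0 (maxn N3 N3')).
move: hi hj hj0 hk1 hk0; rewrite !geq_max => /and3P[hi hi1 hi2] /and3P[hj hj1 hj2].
move=> /and3P[hj01 hj02 hj03] /and3P[hk1 hk2 hk3] /andP[hk0 hk0'].
pose k := (j - j0 + k1)%N.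
have e2 : j%:Z - k%:Z = m.
  by rewrite -[X in X%:Z - _](subnK hj) (push_deg (j - j0) e20).
have le_k : (k0 <= k)%N by apply: leq_trans hk1 _; apply: leq_addl.
pose l := (k - k0 + l0)%N.
have e3 : k%:Z - l%:Z = n.
  by rewrite -[X in X%:Z - _](subnK le_k) (push_deg (k - k0) e30).
have [f ef] := h1 k l e3 (leq_trans hk0 le_k).
have [f' ef'] := h1' k l e3 (leq_trans hk0' le_k).
have [g eg] := h2 j k e2 (leq_trans hj02 hj).
have [g' eg'] := h2' j k e2 (leq_trans hj03 hj).
have [h eh] := h3 i j e1 hi1; have [h' eh'] := h3' i j e1 hi2.
by exists i, j, k, l, e1, e2, e3, f, f', g, g', h, h'; split; split.
Qed.

Lemma kmulDl n m l (e : n + m = l) (x x' : K n) (y : K m) :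
  kmul e (x + x') y = kmul e x y + kmul e x' y.
Proof.
have [i [j [k [l0 [e1 [e2 [e3 [f [f' [g [_ [_ [_ [[-> ->] [-> _] _]]]]]]]]]]]]]] :=
  kcl_chain x x' y y y y.
have e4 := deg_comp e e2 e3.
rewrite -kclD !(kmulE e e2 e3 e4) -kclD; congr kcl.
exact: linear_ext.
Qed.

Lemma kmulDr n m l (e : n + m = l) (x : K n) (y y' : K m) :
  kmul e x (y + y') = kmul e x y + kmul e x y'.
Proof.
have [i [j [k [l0 [e1 [e2 [e3 [f [_ [g [g' [_ [_ [[-> _] [-> ->] _]]]]]]]]]]]]]] :=
  kcl_chain x x y y' y y.
have e4 := deg_comp e e2 e3.
rewrite -kclD !(kmulE e e2 e3 e4) -kclD; congr kcl.
by apply: linear_ext => v /=; rewrite raddfD.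
Qed.

Lemma kmulA n m r nm mr l (e1 : n + m = nm) (e2 : nm + r = l) (e3 : m + r = mr)
    (e4 : n + mr = l) (x : K n) (y : K m) (z : K r) :
  kmul e2 (kmul e1 x y) z = kmul e4 x (kmul e3 y z).
Proof.
have [i [j [k [l0 [d1 [d2 [d3 [f [_ [g [_ [h [_ [[-> _] [-> _] [-> _]]]]]]]]]]]]]]] :=
  kcl_chain x x y y z z.
have d12 := deg_comp e3 d1 d2; have d23 := deg_comp e1 d2 d3.
have d123 := deg_comp e2 d1 d23.
rewrite (kmulE e1 d2 d3 d23) (kmulE e3 d1 d2 d12) (kmulE e2 d1 d23 d123).
rewrite (kmulE e4 d12 d3 d123); congr kcl.
exact: linear_ext.
Qed.

Definition kone : K 0 := kcl (subrr 0%N%:Z) (idfun : hom 0 0).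

Lemma koneE i (e : i%:Z - i%:Z = 0) : kcl e (idfun : hom i i) = kone.
Proof.
elim: i e => [|i ih] e; first by rewrite (Prop_irrelevance e (subrr 0%N%:Z)).
have <- : tstep (idfun : hom i i) = (idfun : hom i.+1 i.+1) := push_id 1 i.
by rewrite (kcl_step (subrr i%:Z) e) ih.
Qed.

Lemma kmul1 n (e : 0 + n = n) (x : K n) : kmul e kone x = x.
Proof.
have [i [j [d [f [_ [_ [-> _ _]]]]]]] := kcl_stage3 x x x.
rewrite -(koneE (subrr j%:Z)) (kmulE e d (subrr j%:Z) d); congr kcl.
exact: linear_ext.
Qed.

Lemma kmulr1 n (e : n + 0 = n) (x : K n) : kmul e x kone = x.
Proof.
have [i [j [d [f [_ [_ [-> _ _]]]]]]] := kcl_stage3 x x x.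
rewrite -(koneE (subrr i%:Z)) (kmulE e (subrr i%:Z) d d); congr kcl.
exact: linear_ext.
Qed.

(* The limit of the rings End(B^⊗i): for n = 0 the chain defining K n is the
   chain of endomorphism rings. *)
Definition Gamma : Type := K 0.
HB.instance Definition _ := GRing.Zmodule.on Gamma.

Fact Gamma_mulA : associative (kmul (addr0 0) : Gamma -> Gamma -> Gamma).
Proof. by move=> x y z; apply/esym/kmulA. Qed.

HB.instance Definition _ := GRing.Zmodule_isPzRing.Build Gamma
  Gamma_mulA (kmul1 (addr0 0)) (kmulr1 (addr0 0))
  (kmulDl (addr0 0)) (kmulDr (addr0 0)).

(* Both actions are composition: End(B^⊗(i-n)) on the left, End(B^⊗i) on the
   right. *)
Section Actions.
Variable n : int.

HB.instance Definition _ := GRing.Zmodule_isLmodule.Build Gamma (K n)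
  (fun a b v => esym (kmulA (addr0 0) (add0r n) (add0r n) (add0r n) a b v))
  (kmul1 (add0r n)) (kmulDr (add0r n))
  (fun v a b => kmulDl (add0r n) a b v).

HB.instance Definition _ := isRightModule.Build Gamma (K n)
  (fun v a b => kmulA (addr0 n) (addr0 n) (addr0 0) (addr0 n) v a b)
  (kmulr1 (addr0 n)) (kmulDl (addr0 n)) (kmulDr (addr0 n)).

HB.instance Definition _ := isBimodule.Build Gamma Gamma (K n)
  (fun a v b => esym (kmulA (add0r n) (addr0 n) (addr0 n) (add0r n) a v b)).

End Actions.

Definition phi n m : tens (K n) (K m) -> K (n + m) :=
  tens_lift (kmul (erefl (n + m))).

Lemma phiE n m (x : K n) (y : K m) : phi (x ⊗ y) = kmul (erefl (n + m)) x y.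
Proof.
apply: tens_liftE; split=> [x1 x2 y1|x1 y1 y2|x1 a y1].
- exact: kmulDl.
- exact: kmulDr.
- exact: kmulA.
Qed.

End DirectLimit.
Arguments phi {S} B n m.

Record lmod_functor (S T : pzRingType) := LmodFunctor {
  fob :> lmodType S -> lmodType T;
  fmap : forall M N : lmodType S, {linear M -> N} -> {linear fob M -> fob N};
  fmap_id : forall M : lmodType S, fmap (idfun : {linear M -> M}) =1 idfun;
  fmap_comp : forall (M N P : lmodType S) (g : {linear N -> P}) (f : {linear M -> N}),
    fmap (g \o f) =1 fmap g \o fmap f
}.

Definition id_functor (S : pzRingType) : lmod_functor S S :=
  @LmodFunctor S S (fun M => M) (fun M N f => f)
    (fun M x => erefl) (fun M N P g f x => erefl).

Section ComposeFunctors.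
Variables (S T U : pzRingType) (G : lmod_functor T U) (F : lmod_functor S T).

Fact comp_fmap_id (M : lmodType S) :
  fmap G (fmap F (idfun : {linear M -> M})) =1 idfun.
Proof.
have -> : fmap F (idfun : {linear M -> M}) = idfun by apply/linear_ext/fmap_id.
exact: fmap_id.
Qed.

Fact comp_fmap_comp (M N P : lmodType S) (g : {linear N -> P}) (f : {linear M -> N}) :
  fmap G (fmap F (g \o f)) =1 fmap G (fmap F g) \o fmap G (fmap F f).
Proof.
have -> : fmap F (g \o f) = (fmap F g \o fmap F f) by apply/linear_ext/fmap_comp.
exact: fmap_comp.
Qed.

Definition comp_functor : lmod_functor S U :=
  @LmodFunctor S U (fun M => G (F M)) (fun M N f => fmap G (fmap F f))
    comp_fmap_id comp_fmap_comp.

End ComposeFunctors.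

Definition nat_isomorphic (S T : pzRingType) (F G : lmod_functor S T) : Prop :=
  exists eta : forall M : lmodType S, {linear F M -> G M},
    (forall M, bijective (eta M)) /\
    (forall (M N : lmodType S) (f : {linear M -> N}) (x : F M),
       eta N (fmap F f x) = fmap G f (eta M x)).

Definition is_equivalence (S T : pzRingType) (F : lmod_functor S T) : Prop :=
  exists G : lmod_functor T S,
    nat_isomorphic (comp_functor G F) (id_functor S) /\
    nat_isomorphic (comp_functor F G) (id_functor T).

Section TensorFunctor.
Variables (L S : pzRingType) (M : bimodType L S).

Fact tens_map_id (N : lmodType S) : tens_map M (idfun : {linear N -> N}) =1 idfun.
Proof.
apply: tens_ext => [||m n]; [exact: raddfB | by [] | by rewrite tens_mapE].
Qed.

Fact tens_map_comp (N P Q : lmodType S) (g : {linear P -> Q}) (f : {linear N -> P}) :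
  tens_map M (g \o f) =1 tens_map M g \o tens_map M f.
Proof.
apply: tens_ext => [||m n]; [exact: raddfB | | by rewrite /= !tens_mapE].
by move=> x y /=; rewrite !raddfB.
Qed.

Definition tens_functor : lmod_functor S L :=
  @LmodFunctor S L (fun N => tens M N) (fun N P f => tens_map M f)
    tens_map_id tens_map_comp.

End TensorFunctor.

Definition invertible_bimodule (G : pzRingType) (M : bimodType G G) : Prop :=
  is_equivalence (tens_functor M).

Definition bimodule_isomorphism (L S : pzRingType) (M N : bimodType L S)
    (f : M -> N) : Prop :=
  [/\ linear f, forall x b, f (x <* b) = f x <* b & bijective f].

Definition left_ideal (A : pzRingType) (I : A -> Prop) : Prop :=
  [/\ I 0, forall x y, I x -> I y -> I (x + y) & forall a x, I x -> I (a * x)].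

(* The descending chain condition on ideals of a commutative ring. *)
Definition artinian (R : comPzRingType) : Prop :=
  forall I : nat -> R -> Prop, (forall k, left_ideal (I k)) ->
    (forall k x, I k.+1 x -> I k x) ->
    exists N : nat, forall k x, (N <= k)%N -> I N x -> I k x.

Definition artin_algebra (R : comPzRingType) (A : pzRingType)
    (iota : algebra_on R A) : Prop :=
  artinian R /\
  exists (k : nat) (g : 'I_k -> A), forall x : A,
    exists c : 'I_k -> R, x = \sum_(i < k) iota (c i) * g i.

Definition maximal_left_ideal (A : pzRingType) (I : A -> Prop) : Prop :=
  [/\ left_ideal I, ~ I 1
    & forall J : A -> Prop, left_ideal J -> (forall x, I x -> J x) ->
        (forall x, J x -> I x) \/ J 1].

Section Jacobson.
Variable A : pzRingType.

Definition jacobson : {pred A} :=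
  fun x => `[< forall I, maximal_left_ideal I -> I x >].

Fact jacobson_closed : zmod_closed jacobson.
Proof.
split=> [|x y /asboolP hx /asboolP hy]; apply/asboolP => I hI.
  by case: (hI) => -[].
case: (hI) => -[_ ID IM] _ _; apply: ID; first exact: hx.
by rewrite -mulN1r; apply: IM; exact: hy.
Qed.
HB.instance Definition _ := GRing.isZmodClosed.Build A jacobson jacobson_closed.

Lemma jacobsonMl a x : x \in jacobson -> a * x \in jacobson.
Proof.
by move=> /asboolP hx; apply/asboolP => I hI; case: (hI) => -[_ _ IM] _ _; apply: IM; exact: hx.
Qed.

Lemma jacobsonMr a x : x \in jacobson -> x * a \in jacobson.
Proof.
move=> /asboolP hx; apply/asboolP => I hI; case: (hI) => -[I0 ID IM] I1 Imax.
case: (pselect (I a)) => [Ia|nIa]; first exact: IM.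
apply: (hx (fun b => I (b * a))); split=> [||J [J0 JD JM] IJ].
- split=> [|u v hu hv|b u hu]; first by rewrite mul0r.
    by rewrite mulrDl; apply: ID.
  by rewrite -mulrA; apply: IM.
- by rewrite mul1r.
case: (pselect (forall b, J b -> I (b * a))) => [h|/existsNP[c /not_implyP[Jc nIc]]].
  by left.
right; pose L z := exists2 u, I u & exists d, z = u + d * (c * a).
have LI : left_ideal L.
  split=> [|_ _ [u Iu [d ->]] [v Iv [e ->]]|b _ [u Iu [d ->]]].
  - by exists 0 => //; exists 0; rewrite mul0r addr0.
  - by exists (u + v); [exact: ID | exists (d + e); rewrite mulrDl addrACA].
  - by exists (b * u); [exact: IM | exists (b * d); rewrite mulrDr mulrA].
case: (Imax L LI) => [u Iu|h|[u Iu [d e1]]].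
- by exists u => //; exists 0; rewrite mul0r addr0.
- case: nIc; apply: h; exists 0 => //; exists 1; by rewrite add0r mul1r.
have e2 : 1 = (1 - a * d * c) + a * d * c by rewrite subrK.
rewrite e2; apply: JD; last exact: JM.
apply: IJ; rewrite mulrBl mul1r.
have -> : a - a * d * c * a = a * u.
  by rewrite -[X in X - _]mulr1 e1 mulrDr !mulrA addrK.
exact: IM.
Qed.

(* The ring A / r; jpi is the projection and jrep a choice of representatives. *)
Definition jquot : Type := Quotient.quot jacobson.
HB.instance Definition _ := GRing.Zmodule.on jquot.

Definition jpi (x : A) : jquot := \pi_(Quotient.quot jacobson) x.
Definition jrep (a : jquot) : A := repr (a : Quotient.quot jacobson).

Lemma jrepK a : jpi (jrep a) = a. Proof. exact: reprK. Qed.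

Lemma jpi_eq x y : jpi x = jpi y <-> x - y \in jacobson.
Proof. by rewrite Quotient.idealrBE; split=> /eqP. Qed.

Lemma jpiB x y : jpi (x - y) = jpi x - jpi y.
Proof. exact: raddfB. Qed.

Lemma jpiD x y : jpi (x + y) = jpi x + jpi y.
Proof. exact: raddfD. Qed.

Definition jmul (a b : jquot) : jquot := jpi (jrep a * jrep b).

Lemma jpiM x y : jmul (jpi x) (jpi y) = jpi (x * y).
Proof.
apply/jpi_eq; set x' := jrep _; set y' := jrep _.
have hx : x' - x \in jacobson by apply/jpi_eq; rewrite jrepK.
have hy : y' - y \in jacobson by apply/jpi_eq; rewrite jrepK.
have -> : x' * y' - x * y = (x' - x) * y' + x * (y' - y).
  by rewrite mulrBl mulrBr addrA subrK.
by apply: rpredD; [apply: jacobsonMr | apply: jacobsonMl].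
Qed.

Fact jmulA : associative jmul.
Proof. by move=> a b c; rewrite -[a]jrepK -[b]jrepK -[c]jrepK !jpiM mulrA. Qed.
Fact jmul1 : left_id (jpi 1) jmul.
Proof. by move=> a; rewrite -[a]jrepK jpiM mul1r. Qed.
Fact jmulr1 : right_id (jpi 1) jmul.
Proof. by move=> a; rewrite -[a]jrepK jpiM mulr1. Qed.
Fact jmulDl : left_distributive jmul +%R.
Proof.
by move=> a b c; rewrite -[a]jrepK -[b]jrepK -[c]jrepK -jpiD !jpiM mulrDl jpiD.
Qed.
Fact jmulDr : right_distributive jmul +%R.
Proof.
by move=> a b c; rewrite -[a]jrepK -[b]jrepK -[c]jrepK -jpiD !jpiM mulrDr jpiD.
Qed.

HB.instance Definition _ :=
  GRing.Zmodule_isPzRing.Build jquot jmulA jmul1 jmulr1 jmulDl jmulDr.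

Record rad := Rad { rad_val :> A; rad_valP : rad_val \in jacobson }.
HB.instance Definition _ := [isSub for rad_val].
HB.instance Definition _ := [Choice of rad by <:].
HB.instance Definition _ := [SubChoice_isSubZmodule of rad by <:].

Definition rad_square_zero : Prop :=
  forall x y, x \in jacobson -> y \in jacobson -> x * y = 0.

(* The ideal r as an A/r-A/r-bimodule, which makes sense since r * r = 0. *)
Definition rad_bimod of rad_square_zero : Type := rad.

Variable h : rad_square_zero.
Local Notation r := (rad_bimod h).
HB.instance Definition _ := GRing.Zmodule.on r.

Definition rad_scale (a : jquot) (x : r) : r :=
  Rad (jacobsonMl (jrep a) (rad_valP x)).
Definition rad_ract (x : r) (a : jquot) : r :=
  Rad (jacobsonMr (jrep a) (rad_valP x)).

Lemma rad_scaleE (a : A) (x : r) : rad_val (rad_scale (jpi a) x) = a * rad_val x.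
Proof.
apply/eqP; rewrite -subr_eq0 -mulrBl; apply/eqP/h; last exact: rad_valP.
by apply/jpi_eq; rewrite jrepK.
Qed.

Lemma rad_ractE (x : r) (a : A) : rad_val (rad_ract x (jpi a)) = rad_val x * a.
Proof.
apply/eqP; rewrite -subr_eq0 -mulrBr; apply/eqP/h; first exact: rad_valP.
by apply/jpi_eq; rewrite jrepK.
Qed.

Let radE (x y : r) : rad_val x = rad_val y -> x = y := @val_inj _ _ rad x y.
Let radD (x y : r) : rad_val (x + y) = rad_val x + rad_val y. Proof. by []. Qed.

Fact rad_scaleA a b x : rad_scale a (rad_scale b x) = rad_scale (a * b) x.
Proof.
apply: radE; rewrite -[a]jrepK -[b]jrepK.
by rewrite -[jpi _ * jpi _]/(jmul _ _) jpiM !rad_scaleE mulrA.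
Qed.
Fact rad_scale1 : left_id 1 rad_scale.
Proof. by move=> x; apply: radE; rewrite -[1]/(jpi 1) rad_scaleE mul1r. Qed.
Fact rad_scaleDr : right_distributive rad_scale +%R.
Proof.
by move=> a x y; apply: radE; rewrite -[a]jrepK radD !rad_scaleE radD mulrDr.
Qed.
Fact rad_scaleDl x : {morph rad_scale^~ x : a b / a + b}.
Proof.
move=> a b; apply: radE; rewrite -[a]jrepK -[b]jrepK.
by rewrite -jpiD radD !rad_scaleE mulrDl.
Qed.
HB.instance Definition _ := GRing.Zmodule_isLmodule.Build jquot r
  rad_scaleA rad_scale1 rad_scaleDr rad_scaleDl.

Fact rad_ractA x a b : rad_ract (rad_ract x a) b = rad_ract x (a * b).
Proof.
apply: radE; rewrite -[a]jrepK -[b]jrepK.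
by rewrite -[jpi _ * jpi _]/(jmul _ _) jpiM !rad_ractE mulrA.
Qed.
Fact rad_ract1 x : rad_ract x 1 = x.
Proof. by apply: radE; rewrite -[1]/(jpi 1) rad_ractE mulr1. Qed.
Fact rad_ractDl x y a : rad_ract (x + y) a = rad_ract x a + rad_ract y a.
Proof. by apply: radE; rewrite -[a]jrepK radD !rad_ractE radD mulrDl. Qed.
Fact rad_ractDr x a b : rad_ract x (a + b) = rad_ract x a + rad_ract x b.
Proof.
apply: radE; rewrite -[a]jrepK -[b]jrepK.
by rewrite -jpiD radD !rad_ractE mulrDr.
Qed.
HB.instance Definition _ := isRightModule.Build jquot r
  rad_ractA rad_ract1 rad_ractDl rad_ractDr.

Fact rad_scale_ract (a : jquot) (x : r) (b : jquot) :
  a *: (x <* b) = (a *: x) <* b.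
Proof.
apply: radE; rewrite -[a]jrepK -[b]jrepK.
rewrite -[LHS]/(rad_val (rad_scale (jpi _) (rad_ract x (jpi _)))).
rewrite -[RHS]/(rad_val (rad_ract (rad_scale (jpi _) x) (jpi _))).
by rewrite !(rad_scaleE, rad_ractE) mulrA.
Qed.
HB.instance Definition _ := isBimodule.Build jquot jquot r rad_scale_ract.

End Jacobson.

(* Main.v *)
(* Let L = A/r.  Call N generated by M when id_N is a sum of maps factoring
   through M.  L is semisimple, so r has a finite dual basis over L, i.e. L
   generates r; tensoring, r^i generates r^(i+1) for every i.  Hence the trace
   ideals of the r^i in L decrease, and where they become stationary r^(i+1)
   generates r^i.  In the direct limit this says that 1 lies in K^1 K^(-1) and in
   K^(-1) K^1, hence in K^n K^(-n) for all n.  Given 1 = sum_i x_i y_i there, the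
   inverse of phi is z |-> sum_i x_i (x) y_i z, and K^(-n) (x) - is inverse to
   K^n (x) -. *)
From HB Require Import structures.
Require Import Defs.
From mathcomp Require Import all_boot all_algebra.
From mathcomp Require Import boolp.

Set Implicit Arguments.
Unset Strict Implicit.
Unset Printing Implicit Defensive.

Import GRing.Theory.
Local Open Scope ring_scope.

(** * Artinian modules *)

Section ArtinianModules.
Variables (S : pzRingType) (V : lmodType S).

Definition submod (N : V -> Prop) : Prop :=
  [/\ N 0, forall x y, N x -> N y -> N (x + y) & forall a x, N x -> N (a *: x)].

Lemma submodB (N : V -> Prop) x y : submod N -> N x -> N y -> N (x - y).
Proof. by case=> _ ND NZ Nx Ny; rewrite -scaleN1r; apply/ND/NZ. Qed.

Lemma submod_sub (N : V -> Prop) x y : submod N -> N (x - y) -> N y -> N x.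
Proof. by case=> _ ND _ h /(ND _ _ h); rewrite subrK. Qed.

Definition artinian_mod : Prop :=
  forall N : nat -> V -> Prop, (forall k, submod (N k)) ->
    (forall k x, N k.+1 x -> N k x) ->
    exists n : nat, forall k x, (n <= k)%N -> N n x -> N k x.

(** If no member of [F] were minimal, each would have a strictly smaller one in [F], and iterating a
    choice of these from [N0] would give a chain that never becomes stationary. *)
Lemma artinian_min (F : (V -> Prop) -> Prop) (N0 : V -> Prop) :
  artinian_mod -> (forall N, F N -> submod N) -> F N0 ->
  exists N, F N /\ forall N', F N' -> (forall x, N' x -> N x) -> forall x, N x -> N' x.
Proof.
move=> dcc FS FN0; apply: contrapT => /forallNP noMin.
have next (N : {N | F N}) : exists N' : {N | F N},
    (forall x, sval N' x -> sval N x) /\ ~ (forall x, sval N x -> sval N' x).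
  case: N => N FN; have /not_andP[//|/existsNP[N']] := noMin N.
  by move=> /not_implyP[FN' /not_implyP[le h]]; exists (exist _ N' FN').
have [nxt nxtP] := choice next.
pose c k := iter k nxt (exist _ N0 FN0).
have [k|k x|n h] := dcc (fun k => sval (c k)).
- exact/FS/(svalP (c k)).
- by case: (nxtP (c k)) => le _; apply: le.
by case: (nxtP (c n)) => _; apply=> x; apply: (h n.+1).
Qed.

End ArtinianModules.

(** [F] embeds the ordered set of submodules of [W] into that of [V], so chains can be compared in
    [V]. The rings may differ: this carries the chain condition from [A] over [R] to modules over
    [A/r]. *)
Lemma artinian_mod_transfer (R S : pzRingType) (V : lmodType R) (W : lmodType S)
    (F : (W -> Prop) -> V -> Prop) :
  (forall N, submod N -> submod (F N)) ->
  (forall N N' : W -> Prop, (forall x, N x -> N' x) -> forall x, F N x -> F N' x) ->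
  (forall N N' : W -> Prop, (forall x, F N x -> F N' x) -> forall x, N x -> N' x) ->
  artinian_mod V -> artinian_mod W.
Proof.
move=> FS Fmono Frefl dcc N NS Nle.
have [k|k|n h] := dcc (fun k => F (N k)); first exact/FS/NS.
  by apply: Fmono; apply: Nle.
exists n => k x le_nk; move: x; apply: (Frefl) => x; exact: h.
Qed.

(** * Finitely generated modules over a commutative artinian ring *)

Section FinitelyGenerated.
Variables (R : comPzRingType) (V : lmodType R).

Fixpoint span (s : seq V) (x : V) : Prop :=
  if s is y :: s' then exists a : R, span s' (x - a *: y) else x = 0.

Lemma span_submod s : submod (span s).
Proof.
elim: s => [|y s [ih0 ihD ihZ]] /=; first split=> [//|_ _ -> ->|a _ ->].
- by rewrite addr0.
- by rewrite scaler0.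
split=> [|u v [a hu] [b hv]|a u [b hu]].
- by exists 0; rewrite scale0r subrr.
- by exists (a + b); rewrite scalerDl opprD addrACA; apply: ihD.
- by exists (a * b); rewrite -scalerA -scalerBr; apply: ihZ.
Qed.

(** Induction on the generators. For [y :: s] two chains become stationary: the [N k] inside
    [span s], by induction, and in [R] the ideals of coefficients of [y] in elements of [N k]. Past
    both stages the original chain is stationary on the span. *)
Lemma artinian_span (s : seq V) (N : nat -> V -> Prop) : artinian R ->
  (forall k, submod (N k)) -> (forall k x, N k.+1 x -> N k x) ->
  exists n : nat, forall k x, (n <= k)%N -> span s x -> N n x -> N k x.
Proof.
move=> dcc; elim: s => [|y s ih] in N * => NS Nle.
  by exists 0%N => k x _ -> _; case: (NS k).
have mono m k x : (m <= k)%N -> N k x -> N m x.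
  by move=> /subnK <-; elim: (k - m)%N => // d ihd /Nle.
have [n1 h1] := ih N NS Nle.
have [s0 sD sZ] := span_submod s.
have [k|k c [u su Nu]|n2 h2] := dcc (fun k c => exists2 u, span s u & N k (c *: y + u)).
- have [N0 ND NZ] := NS k.
  split=> [|c d [u su Nu] [v sv Nv]|a c [u su Nu]].
  + by exists 0 => //; rewrite scale0r addr0.
  + by exists (u + v); [exact: sD | rewrite scalerDl addrACA; apply: ND].
  + by exists (a *: u); [exact: sZ | rewrite -scalerA -scalerDr; apply: NZ].
- by exists u => //; apply: Nle.
exists (maxn n1 n2) => k x; rewrite geq_max => /andP[le1 le2] [a sx] Nx.
have [u su Nu] : exists2 u, span s u & N k (a *: y + u).
  apply: (h2 k a le2); exists (x - a *: y) => //; rewrite addrC subrK.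
  by apply: mono Nx; rewrite leq_maxr.
(* [x] and [a *: y + u] have the same coefficient at [y], so their difference lies in [span s]; it
   also lies in [N n1], hence in [N k]. *)
apply: (submod_sub (NS k) _ Nu); apply: (h1 k _ le1).
  by rewrite opprD addrA; exact: submodB (span_submod s) sx su.
apply: (mono _ (maxn n1 n2)); first by rewrite leq_maxl.
apply: submodB (NS _) Nx _; apply: mono Nu.
by rewrite geq_max le1 le2.
Qed.

Lemma artinian_mod_fg (s : seq V) :
  artinian R -> (forall x, span s x) -> artinian_mod V.
Proof.
move=> dcc sV N NS Nle; have [n h] := artinian_span s dcc NS Nle.
by exists n => k x le_nk; apply: h.
Qed.

End FinitelyGenerated.

(* Semisimplicity is used in the form: every left ideal I contains an idempotent e
   with y * e = y on I. *)
Section Semisimple.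
Variable S : pzRingType.
Hypothesis dcc : artinian_mod (S^o : lmodType S).
Hypothesis semiprime : forall a : S, (forall b, b * a * (b * a) = 0) -> a = 0.

(** Brauer's lemma. A minimal nonzero left ideal [L] inside [I] contains some [x] with [x * x != 0],
    so [L x = L] and [x = e * x] with [e] in [L]. The annihilator of [x] in [L] omits [x], hence is
    zero by minimality, and it contains [e * e - e]. *)
Lemma nonzero_idempotent (I : S -> Prop) a : left_ideal I -> I a -> a != 0 ->
  exists e, [/\ I e, e != 0 & e * e = e].
Proof.
move=> II Ia a0.
pose F (L : S -> Prop) := [/\ left_ideal L, forall x, L x -> I x & exists2 x, L x & x != 0].
have [||L [[LI LsubI [y Ly y0]] Lmin]] := @artinian_min S S^o F I dcc.
- by move=> L [].
- by split=> //; exists a.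
have [L0 LD LM] := LI.
have [x Lx xx0] : exists2 x, L x & x * x != 0.
  apply: contrapT => h; case/eqP: y0; apply: semiprime => b.
  by apply: contrapT => /eqP hb; apply: h; exists (b * y) => //; apply: LM.
have x0 : x != 0 by apply: contraNneq xx0 => ->; rewrite mulr0.
have minE (L' : S -> Prop) z : left_ideal L' -> (forall u, L' u -> L u) ->
    L' z -> z != 0 -> forall u, L u -> L' u.
  move=> L'I L'L L'z z0; apply: (Lmin _) => //; split=> //; last by exists z.
  by move=> u /L'L/LsubI.
have [e Le ex] : exists2 e, L e & x = e * x.
  apply: (minE (fun u => exists2 e, L e & u = e * x) (x * x)) => //.
  - split=> [|_ _ [u Lu ->] [v Lv ->]|b _ [u Lu ->]].
    + by exists 0; rewrite ?mul0r.
    + by exists (u + v); [exact: LD | rewrite mulrDl].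
    + by exists (b * u); [exact: LM | rewrite mulrA].
  - by move=> _ [u Lu ->]; apply: LM.
  - by exists x.
exists e; split; first exact: LsubI.
  by apply: contraNneq x0 => e0; rewrite ex e0 mul0r.
apply/eqP; rewrite -subr_eq0; apply: contraNT xx0 => ee0.
suff [_ ->] : L x /\ x * x = 0 by [].
apply: (minE (fun u => L u /\ u * x = 0) (e * e - e)) => //.
- split=> [|u v [Lu ux] [Lv vx]|b u [Lu ux]].
  + by rewrite mul0r.
  + by rewrite mulrDl ux vx addr0; split=> //; apply: LD.
  + by rewrite -mulrA ux mulr0; split=> //; apply: LM.
- by move=> u [].
- rewrite mulrBl -mulrA -!ex subrr; split=> //.
  by rewrite -mulN1r; apply: LD; apply: LM.
Qed.

(** Take an idempotent [e] of [I] whose annihilator [{y in I | y * e = 0}] is minimal. It contains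
    every [y - y * e]; were it nonzero, it would contain a nonzero idempotent [f], and [e] could be
    improved. *)
Lemma left_ideal_idempotent (I : S -> Prop) : left_ideal I ->
  exists e, [/\ I e, e * e = e & forall y, I y -> y * e = y].
Proof.
move=> II; have [I0 ID IM] := II.
have IB x y : I x -> I y -> I (x - y).
  by move=> Ix Iy; rewrite -mulN1r; apply/ID/IM.
pose F (N : S -> Prop) := exists e, [/\ I e, e * e = e & N = fun y => I y /\ y * e = 0].
have FI N : F N -> left_ideal N.
  move=> [e [_ _ ->]]; split=> [|u v [Iu ue] [Iv ve]|b u [Iu ue]].
  - by rewrite mul0r.
  - by rewrite mulrDl ue ve addr0; split=> //; apply: ID.
  - by rewrite -mulrA ue mulr0; split=> //; apply: IM.
have [|N [[e [Ie ee eN]] Nmin]] := @artinian_min S S^o F (fun y => I y /\ y * 0 = 0) dcc FI.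
  by exists 0; rewrite mulr0.
have NI : left_ideal N by apply: FI; exists e.
subst N.
exists e; split=> // y Iy; apply/esym/eqP; rewrite -subr_eq0; apply: contrapT => /negP y0.
have [||f [[If fe] f0 ff]] := @nonzero_idempotent _ (y - y * e) NI.
- split; first by apply: IB => //; apply: IM.
  by rewrite mulrBl -mulrA ee subrr.
- by [].
(* From [e' * e = e] the annihilator of [e'] is contained in that of [e]; from [f * e' = f] it omits
   [f], so it is strictly smaller. *)
pose e' := e + f - e * f.
have e'e : e' * e = e by rewrite mulrBl mulrDl -mulrA fe mulr0 subr0 addr0.
have fe' : f * e' = f by rewrite mulrBr mulrDr mulrA fe mul0r subr0 add0r.
have ee' : e * e' = e by rewrite mulrBr mulrDr mulrA ee addrK.
have Fe' : F (fun y => I y /\ y * e' = 0).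
  exists e'; split=> //; first by apply: IB; [exact: ID | exact: IM].
  by rewrite {1}/e' mulrBl mulrDl -mulrA ee' fe'.
have [||_ f0'] := Nmin _ Fe' _ f.
- by move=> u [Iu ue]; rewrite -e'e mulrA ue mul0r.
- by [].
by case/eqP: f0; rewrite -fe'.
Qed.

End Semisimple.

(** * Modules generating one another *)

Definition linear_of (S : pzRingType) (M N : lmodType S) (f : M -> N)
    (f_lin : linear f) : {linear M -> N} :=
  HB.pack f (GRing.isLinear.Build S M N *:%R f f_lin).

(* N is a direct summand of a finite direct sum of copies of M. *)
Definition generates (S : pzRingType) (M N : lmodType S) : Prop :=
  exists s : seq ({linear M -> N} * {linear N -> M}),
    forall x, \sum_(p <- s) p.1 (p.2 x) = x.

Section Generates.
Variable S : pzRingType.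
Implicit Types M N P : lmodType S.

Lemma generates_trans M N P : generates M N -> generates N P -> generates M P.
Proof.
move=> [s sE] [t tE].
exists [seq ((q.1 \o p.1 : {linear M -> P}),
             (p.2 \o q.2 : {linear P -> M})) |
             q : {linear N -> P} * {linear P -> N} <- t,
             p : {linear M -> N} * {linear N -> M} <- s].
move=> x; rewrite big_allpairs_dep -[RHS]tE; apply: eq_bigr => q _ /=.
by rewrite -[in RHS](sE (q.2 x)) raddf_sum.
Qed.

Lemma generates_tens (B : bimodType S S) M N :
  generates M N -> generates (tens B M) (tens B N).
Proof.
move=> [s sE]; exists [seq ((tens_map B p.1 : {linear tens B M -> tens B N}),
             (tens_map B p.2 : {linear tens B N -> tens B M})) | p <- s] => x.
rewrite big_map /=; elim/tens_ind: x => [b v|x y hx hy].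
  rewrite -[in RHS](sE v); under eq_bigr => p _ do rewrite !tens_mapE.
  have tmk0 : b ⊗ (0 : N) = 0 by apply: (addrI (b ⊗ 0)); rewrite -tmkDr !addr0.
  exact/esym/(big_morph _ (tmkDr b) tmk0).
by rewrite -{2}hx -{2}hy -sumrB; apply: eq_bigr => p _; rewrite !raddfB.
Qed.

(** The map [b |-> b ⊗ 1] is split by [b ⊗ a |-> b a]. This is needed because [tpow B 1] is
    [tens B S^o] rather than [B] itself. *)
Lemma generates_tens1 (B : bimodType S S) : generates B (tens B S^o).
Proof.
have fP : linear (fun b : B => b ⊗ (1 : S^o)).
  by move=> a u v; rewrite tmkDl scale_tmk.
have gB : balanced (fun (b : B) (a : S^o) => b <* (a : S)).
  split=> [b b' a|b a a'|b a a']; [exact: ractDl | exact: ractDr | exact: ractA].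
have gP : linear (tens_lift (fun (b : B) (a : S^o) => b <* (a : S))).
  have subP := tens_lift_is_additive gB.
  have addP x y : tens_lift (fun (b : B) (a : S^o) => b <* (a : S)) (x + y) =
      tens_lift (fun (b : B) (a : S^o) => b <* (a : S)) x +
      tens_lift (fun (b : B) (a : S^o) => b <* (a : S)) y.
    by have := subP (x + y) y; rewrite addrK => ->; rewrite subrK.
  move=> a u v; rewrite addP; congr (_ + _).
  elim/tens_ind: u => [b c|x y hx hy].
    by rewrite scale_tmk !tens_liftE // scale_ract.
  by rewrite scalerBr !subP hx hy scalerBr.
exists [:: (linear_of fP, linear_of gP)] => x; rewrite big_seq1 /=.
elim/tens_ind: x => [b a|x y hx hy].
  by rewrite (tens_liftE gB) tmk_mid; congr (_ ⊗ _); apply: mulr1.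
by rewrite (tens_lift_is_additive gB) -[LHS]/(linear_of fP _) raddfB /= hx hy.
Qed.

(** * Trace ideals *)

Definition trace_ideal M (a : S) : Prop :=
  exists s : seq ({linear M -> S^o} * M), a = \sum_(p <- s) p.1 p.2.

Lemma trace_ideal_left M : left_ideal (trace_ideal M).
Proof.
split=> [|_ _ [s ->] [t ->]|a _ [s ->]].
- by exists [::]; rewrite big_nil.
- by exists (s ++ t); rewrite big_cat.
exists [seq (p.1, a *: p.2) | p <- s].
by rewrite big_map mulr_sumr; apply: eq_bigr => p _ /=; rewrite linearZ.
Qed.

Lemma generates_trace M N a : generates M N -> trace_ideal N a -> trace_ideal M a.
Proof.
move=> [s sE] [t ->].
exists [seq ((q.1 \o p.1 : {linear M -> S^o}), p.2 q.2) |
             q : {linear N -> S^o} * N <- t,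
             p : {linear M -> N} * {linear N -> M} <- s].
rewrite big_allpairs_dep; apply: eq_bigr => q _ /=.
by rewrite -{1}(sE q.2) raddf_sum.
Qed.

(** Expanding twice in the dual basis of [N] writes [x] as a sum of terms
    [p.2 x * q.2 (p.1 1) *: q.1 1]. The middle factor lies in the trace ideal of [N], hence is a sum
    of values [h m] with [m] in [M], and [x |-> p.2 x *: m] followed by [m' |-> h m' *: q.1 1]
    factors through [M]. *)
Lemma generates_of_trace M N : generates S^o N ->
  (forall a, trace_ideal N a -> trace_ideal M a) -> generates M N.
Proof.
move=> [s sE] le.
pose thru (phi : N -> N) := exists t : seq ({linear M -> N} * {linear N -> M}),
  forall x, \sum_(p <- t) p.1 (p.2 x) = phi x.
have thru_sum I (r : seq I) (phi : I -> N -> N) :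
    (forall i, thru (phi i)) -> thru (fun x => \sum_(i <- r) phi i x).
  move=> h; elim: r => [|i r [t tE]]; first by exists [::] => x; rewrite !big_nil.
  have [u uE] := h i; exists (u ++ t) => x.
  by rewrite big_cat big_cons tE uE.
have [t tE] : thru (fun x => \sum_(p <- s) \sum_(q <- s)
    (p.2 x : S) *: ((q.2 (p.1 (1 : S)) : S) *: q.1 (1 : S))).
  apply: (thru_sum) => p; apply: (thru_sum) => q.
  have [|t tE] := le (q.2 (p.1 (1 : S))).
    by exists [:: (q.2, p.1 (1 : S))]; rewrite big_seq1.
  have fP (h : M * {linear M -> S^o}) : linear (fun m => (h.2 m : S) *: q.1 (1 : S)).
    by move=> a u v; rewrite linearP scalerDl scalerA.
  have gP (h : M * {linear M -> S^o}) : linear (fun x => (p.2 x : S) *: h.1).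
    by move=> a u v; rewrite linearP scalerDl scalerA.
  exists [seq (linear_of (fP (h.2, h.1)), linear_of (gP (h.2, h.1))) | h <- t] => x.
  rewrite big_map tE scaler_suml scaler_sumr; apply: eq_bigr => h _ /=.
  by rewrite linearZ /= scalerA.
exists t => x; rewrite tE -[RHS]sE; apply: eq_bigr => p _.
rewrite -scaler_sumr.
have -> : \sum_(q <- s) (q.2 (p.1 (1 : S)) : S) *: q.1 (1 : S) = p.1 (1 : S).
  rewrite -[RHS]sE; apply: eq_bigr => q _; rewrite -linearZ; congr (q.1 _).
  exact: mulr1.
by rewrite -linearZ; congr (p.1 _); apply: mulr1.
Qed.

Lemma generates_tpowS (B : bimodType S S) i :
  generates S^o B -> generates (tpow B i) (tpow B i.+1).
Proof.
move=> hB; elim: i => [|i ih]; last exact: generates_tens.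
exact: generates_trans hB (generates_tens1 B).
Qed.

Lemma generates_tpow_pred (B : bimodType S S) :
  artinian_mod (S^o : lmodType S) -> generates S^o B ->
  exists i, generates (tpow B i.+1) (tpow B i).
Proof.
move=> dcc hB.
have [k|k a|i h] := dcc (fun k => trace_ideal (tpow B k)).
- exact: trace_ideal_left.
- exact/generates_trace/generates_tpowS.
exists i; apply: generates_of_trace => [|a]; last exact: h.
elim: i {h} => [|i ih]; last exact: generates_trans ih (generates_tpowS i hB).
exists [:: ((idfun : {linear S^o -> S^o}), (idfun : {linear S^o -> S^o}))] => x.
by rewrite big_seq1.
Qed.

End Generates.

(** * Dual bases over a semisimple ring *)

Section DualBasis.
Variables (S : pzRingType) (V : lmodType S).
Hypothesis idempotent_gen : forall I : S -> Prop, left_ideal I ->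
  exists e, [/\ I e, e * e = e & forall y, I y -> y * e = y].

(** The coordinates [c i] are total functions on [V], constrained only on [N]; this avoids a module
    structure on a subtype. *)
Definition dual_basis_on (N : V -> Prop) : Prop :=
  exists (k : nat) (c : nat -> V -> S) (y : nat -> V),
    (forall i a u v, N u -> N v -> c i (a *: u + v) = a * c i u + c i v) /\
    (forall x, N x -> x = \sum_(0 <= i < k) c i x *: y i).

Definition adjoin (N : V -> Prop) (y x : V) : Prop := exists a : S, N (x - a *: y).

Lemma adjoin_submod (N : V -> Prop) y : submod N -> submod (adjoin N y).
Proof.
move=> [N0 ND NZ]; split=> [|u v [a hu] [b hv]|a u [b hu]].
- by exists 0; rewrite scale0r subrr.
- by exists (a + b); rewrite scalerDl opprD addrACA; apply: ND.
- by exists (a * b); rewrite -scalerA -scalerBr; apply: NZ.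
Qed.

(* If I = {a | a y in N} is generated by the idempotent e, then (1 - e) y spans
   a complement of N in N + S y, and it is projective. *)
Lemma dual_basis_adjoin (N : V -> Prop) y : submod N -> dual_basis_on N -> ~ N y ->
  exists y', [/\ ~ N y', forall a : S, N (a *: y') -> a *: y' = 0
                & dual_basis_on (adjoin N y')].
Proof.
move=> NS [k [c [z [c_lin cE]]]] Ny; have [N0 ND NZ] := NS.
have [|e [Ie ee eI]] := idempotent_gen (I := fun a => N (a *: y)).
  split=> [|a b Na Nb|a b Nb]; first by rewrite scale0r.
    by rewrite scalerDl; apply: ND.
  by rewrite -scalerA; apply: NZ.
pose f := 1 - e; pose y' := f *: y.
have ff : f * f = f by rewrite /f mulrBr mulr1 mulrBl mul1r ee subrr subr0.
have fy' : f *: y' = y' by rewrite scalerA ff.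
have Nf a : N (a *: y') -> a * f = 0.
  rewrite scalerA => /eI <-.
  by rewrite /f -mulrA mulrBl mul1r ee subrr mulr0.
exists y'; split=> [Ny'|a Na|].
- apply: Ny; apply: submod_sub NS _ Ie.
  by rewrite -{1}[y]scale1r -scalerBl.
- by rewrite -fy' scalerA Nf // scale0r.
have [al alP] : {al : V -> S & forall x, adjoin N y' x -> N (x - al x *: y')}.
  apply: (choice (P := fun x a => adjoin N y' x -> N (x - a *: y'))) => x.
  by case: (pselect (adjoin N y' x)) => [[a Na]|nx]; [exists a | exists 0].
(* The coefficient [al x] is an arbitrary choice ([0] outside [adjoin N y']) and need not be linear
   in [x]. Multiplying by [f] does not change its product with [y'] and makes it unique, whence
   linearity on [adjoin N y']. *)
pose be x := al x * f.
have beP x : adjoin N y' x -> N (x - be x *: y').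
  by move=> /alP; rewrite /be -scalerA fy'.
have be_uniq x b : adjoin N y' x -> N (x - b *: y') -> b * f = b -> be x = b.
  move=> /beP h1 h2 bf; apply/eqP; rewrite -subr_eq0; apply/eqP.
  have : (be x - b) * f = be x - b by rewrite mulrBl bf /be -mulrA ff.
  move=> <-; apply: Nf.
  have := submodB NS h2 h1.
  by rewrite opprB addrC addrA subrK scalerBl.
have be_lin a u v : adjoin N y' u -> adjoin N y' v -> be (a *: u + v) = a * be u + be v.
  move=> hu hv; have [_ AD AZ] := adjoin_submod y' NS.
  apply: be_uniq; first by apply: AD => //; apply: AZ.
    rewrite scalerDl opprD addrACA -scalerA -scalerBr.
    by apply: ND; [apply/NZ/beP | apply: beP].
  by rewrite mulrDl -mulrA /be -!mulrA !ff.
exists k.+1, (fun i x => if i is j.+1 then c j (x - be x *: y') else be x).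
exists (fun i => if i is j.+1 then z j else y').
split=> [[|i] a u v hu hv|x hx].
- exact: be_lin.
- rewrite -c_lin; try exact: beP.
  by rewrite be_lin // scalerDl opprD addrACA -scalerA -scalerBr.
by rewrite big_nat_recl //= -cE; [rewrite addrC subrK | apply: beP].
Qed.

(* Otherwise there would be an infinite independent sequence y, and the spans of
   its tails would not become stationary. *)
Lemma generates_artinian : artinian_mod V -> generates S^o V.
Proof.
move=> dcc; apply: contrapT => nogen.
pose T := {N : V -> Prop | submod N /\ dual_basis_on N}.
have next (N : T) : exists p : T * V,
    [/\ ~ sval N p.2, forall a : S, sval N (a *: p.2) -> a *: p.2 = 0
       & forall x, sval p.1 x <-> adjoin (sval N) p.2 x].
  case: N => N [NS Nb] /=.
  have [y Ny] : exists y, ~ N y.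
    apply/existsNP => Nall; apply: nogen.
    have [k [c [y [c_lin cE]]]] := Nb.
    have c_linear i : linear (c i : V -> S^o) by move=> a u v; exact: c_lin.
    have y_linear i : linear (fun a : S^o => (a : S) *: y i).
      by move=> a u v; rewrite scalerDl scalerA.
    exists [seq (linear_of (y_linear i), linear_of (c_linear i)) | i <- index_iota 0 k] => x.
    by rewrite big_map -cE.
  have [y' [Ny' y'0 basis]] := dual_basis_adjoin NS Nb Ny.
  by exists (exist _ (adjoin N y') (conj (adjoin_submod y' NS) basis), y').
have [nxt nxtP] := choice next.
have [N0S N0b] : submod (fun x : V => x = 0) /\ dual_basis_on (fun x : V => x = 0).
  split; first split=> [//|_ _ -> ->|a _ ->]; rewrite ?addr0 ?scaler0 //.
  exists 0%N, (fun _ _ => 0), (fun _ => 0); split=> [i a u v _ _|x ->].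
    by rewrite mulr0 addr0.
  by rewrite big_geq.
pose c k : T := iter k (fun N => (nxt N).1) (exist _ _ (conj N0S N0b)).
pose y k := (nxt (c k)).2.
have cS k : submod (sval (c k)) by case: (svalP (c k)).
have ny k : ~ sval (c k) (y k) by case: (nxtP (c k)).
have y0 k (a : S) : sval (c k) (a *: y k) -> a *: y k = 0.
  by case: (nxtP (c k)) => _ + _; apply.
have cnext k x : sval (c k.+1) x <-> adjoin (sval (c k)) (y k) x by case: (nxtP (c k)).
have cmono k l x : (k <= l)%N -> sval (c k) x -> sval (c l) x.
  move=> /subnK <-; elim: (l - k)%N => // d ih /ih h.
  by apply/cnext; exists 0; rewrite scale0r subr0.
have yc k l : (k < l)%N -> sval (c l) (y k).
  move=> lt_kl; apply: cmono lt_kl _; apply/cnext; exists 1.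
  by rewrite scale1r subrr; case: (cS k).
(* [seg k d] is the span of the [d] vectors [y k], ..., [y (k + d - 1)]; the union over [d] is the
   tail whose chain is tested below. *)
pose seg := fix seg k d x :=
  if d is d'.+1 then exists a : S, seg k d' (x - a *: y (k + d')%N) else x = 0.
have segS k d : submod (seg k d).
  elim: d => [|d ih] /=; last exact: adjoin_submod.
  by split=> [//|_ _ -> ->|a _ ->]; rewrite ?addr0 ?scaler0.
have seg_mono k d d' x : (d <= d')%N -> seg k d x -> seg k d' x.
  move=> /subnK <-; elim: (d' - d)%N => // j ih /ih h.
  by exists 0; rewrite scale0r subr0.
have segc k d x : seg k d x -> sval (c (k + d)%N) x.
  elim: d x => [x ->|d ih x [a /ih h]]; first by case: (cS (k + 0)%N).
  by rewrite addnS; apply/cnext; exists a.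
have [k|k x [d]|k tail] := dcc (fun k x => exists d, seg k d x).
- split=> [|u v [d hu] [d' hv]|a u [d hu]].
  + by exists 0%N.
  + exists (maxn d d'); have [_ D _] := segS k (maxn d d').
    apply: D; [apply: seg_mono hu | apply: seg_mono hv]; rewrite ?leq_maxl ?leq_maxr //.
  + by exists d; have [_ _ Z] := segS k d; apply: Z.
- move=> h; exists d.+1; elim: d x h => [x ->|d ih x [a /ih h]].
    by exists 0; rewrite scale0r subrr.
  by exists a; rewrite addnS -addSn.
have [||d] := tail k.+1 (y k) => //.
  by exists 1%N; exists 1; rewrite addn0 scale1r subrr.
(* Now [y k] is a combination of [d] later vectors. The term of highest index lies in the submodule
   generated by the earlier ones, so it vanishes by [y0]; removing terms in this way ends with
   [y k = 0], against [ny]. *)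
elim: d => [yk0|d ih [a h]].
  by apply: (ny k); rewrite yk0; case: (cS k).
apply: ih; move: (h); suff -> : a *: y (k.+1 + d)%N = 0 by rewrite subr0.
apply: y0; have := submodB (cS _) (yc k (k.+1 + d)%N (leq_addr d k.+1)) (segc _ _ _ h).
by rewrite opprB addrC subrK.
Qed.

End DualBasis.

(** * Strongly graded direct limits *)

Lemma zmod_morphism0 (U V : zmodType) (f : U -> V) : zmod_morphism f -> f 0 = 0.
Proof. by move=> fB; rewrite -(subrr 0) fB subrr. Qed.

Lemma zmod_morphismD (U V : zmodType) (f : U -> V) :
  zmod_morphism f -> {morph f : x y / x + y}.
Proof.
move=> fB x y; rewrite -[in LHS](opprK y) fB -[- y]sub0r fB (zmod_morphism0 fB).
by rewrite sub0r opprK.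
Qed.

Lemma tmk_suml (S : pzRingType) (M : rmodType S) (N : lmodType S) I (s : seq I)
    (F : I -> M) (v : N) : (\sum_(i <- s) F i) ⊗ v = \sum_(i <- s) F i ⊗ v.
Proof.
apply: (big_morph (fun m : M => m ⊗ v) (fun m m' => tmkDl m m' v)).
by apply: (addrI (0 ⊗ v)); rewrite -tmkDl !addr0.
Qed.

Section StronglyGraded.
Variables (S : pzRingType) (B : bimodType S S).
Local Notation K := (K B).
Local Notation G := (Gamma B).
Local Notation phi := (phi B).

Lemma kmul_suml n m l (e : n + m = l) I (s : seq I) (F : I -> K n) (y : K m) :
  kmul e (\sum_(i <- s) F i) y = \sum_(i <- s) kmul e (F i) y.
Proof.
apply: (big_morph (fun x => kmul e x y) (fun x x' => kmulDl e x x' y)).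
by apply: (addrI (kmul e 0 y)); rewrite -kmulDl !addr0.
Qed.

Lemma kmul_sumr n m l (e : n + m = l) I (s : seq I) (x : K n) (F : I -> K m) :
  kmul e x (\sum_(i <- s) F i) = \sum_(i <- s) kmul e x (F i).
Proof.
apply: (big_morph (kmul e x) (kmulDr e x)).
by apply: (addrI (kmul e x 0)); rewrite -kmulDr !addr0.
Qed.

(** As [e] forces [m = - n], this for all [n] is the condition that the graded ring formed by the
    [K n] is strongly graded. *)
Definition splits_one (n m : int) (e : n + m = 0) : Prop :=
  exists s : seq (K n * K m), \sum_(p <- s) kmul e p.1 p.2 = kone B.


Lemma kcl_sum n i j (d : i%:Z - j%:Z = n) I (s : seq I)
    (F : I -> {linear tpow B i -> tpow B j}) (f : {linear tpow B i -> tpow B j}) :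
  (forall x, f x = \sum_(p <- s) F p x) -> kcl d f = \sum_(p <- s) kcl d (F p).
Proof.
have [g gE ->] : exists2 g : {linear tpow B i -> tpow B j},
    forall x, g x = \sum_(p <- s) F p x & \sum_(p <- s) kcl d (F p) = kcl d g.
  elim: s => [|p s [g gE sE]].
    by exists \0 => [x|]; rewrite big_nil // (kzeroE B d).
  exists (F p \+ g) => [x|]; first by rewrite big_cons -gE.
  by rewrite big_cons sE kclD.
by move=> fE; congr kcl; apply: linear_ext => x; rewrite fE gE.
Qed.

(** In a decomposition of the identity of [tpow B j] through [tpow B i], the maps out of [tpow B i]
    have degree [n] and those into it degree [m]; the class of the identity is the unit at every
    stage. *)
Lemma generates_splits_one i j (n m : int) (e : n + m = 0) : i%:Z - j%:Z = n ->
  generates (tpow B i) (tpow B j) -> splits_one e.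
Proof.
move=> d [s sE]; have d' : j%:Z - i%:Z = m.
  by rewrite -opprB d; apply/eqP; rewrite eq_sym -addr_eq0 addrC e.
exists [seq (kcl d p.1, kcl d' p.2) | p <- s].
rewrite big_map -(koneE B (subrr j%:Z)).
under eq_bigr => p _ do rewrite (kmulE e d' d (subrr j%:Z)).
by apply/esym/kcl_sum => x; rewrite -[LHS]sE.
Qed.

(** Insert one decomposition of the unit in the middle of the other: [x y = x 1 y] is the sum of the
    [(x x') (y' y)]. *)
Lemma splits_oneD (n n' m m' l l' : int) (e : n + n' = 0) (e' : m + m' = 0)
    (h : l + l' = 0) : n + m = l -> splits_one e -> splits_one e' -> splits_one h.
Proof.
move=> nml [s sE] [t tE].
have nml' : m' + n' = l'.
  by apply: (addrI l); rewrite h -nml addrA -(addrA n) e' addr0.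
have mmn : m + l' = n' by rewrite -nml' addrA e' add0r.
exists [seq (kmul nml p.1 q.1, kmul nml' q.2 p.2) | p <- s, q <- t].
rewrite big_allpairs_dep -sE; apply: eq_bigr => p _ /=.
under eq_bigr => q _ do rewrite (kmulA nml h mmn e) -(kmulA e' (add0r n') nml' mmn).
by rewrite -kmul_sumr -kmul_suml tE kmul1.
Qed.

Lemma splits_one_all (h1 : 1 + -1 = 0 :> int) (h2 : -1 + 1 = 0 :> int) :
  splits_one h1 -> splits_one h2 -> forall (n m : int) (e : n + m = 0), splits_one e.
Proof.
move=> s1 s2.
have step (d d' : int) (h : d + d' = 0) k : splits_one h ->
    forall (n m : int) (e : n + m = 0), n = d *+ k -> splits_one e.
  move=> sd; elim: k => [|k ih] n m e; rewrite ?mulr0n ?mulrS => en.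
    subst n; have em : m = 0 by rewrite -[m]add0r.
    subst m.
    by exists [:: (kone B, kone B)]; rewrite big_seq1 kmul1.
  apply: (splits_oneD (e' := subrr (d *+ k))) sd (ih _ _ _ erefl).
  by rewrite en.
move=> n m e; case: (intP n) e => [|k|k] e.
- exact: (step _ _ h1 0%N s1).
- by apply: (step _ _ h1 k.+1 s1); rewrite natz.
- by apply: (step _ _ h2 k.+1 s2); rewrite mulNrn natz.
Qed.

Lemma kmul_balanced n m l (e : n + m = l) : balanced (kmul e : K n -> K m -> K l).
Proof.
by split=> [x x' y|x y y'|x a y]; [exact: kmulDl | exact: kmulDr | exact: kmulA].
Qed.

Lemma phi_is_additive n m : zmod_morphism (phi n m).
Proof. exact: tens_lift_is_additive (kmul_balanced _). Qed.

(** * Bijectivity of the product maps *)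

Section Isomorphism.
Variables n m : int.
Hypothesis hn : splits_one (subrr n).

Lemma phi_bijective : bijective (phi n m).
Proof.
have [s sE] := hn.
have e : - n + (n + m) = m by rewrite addKr.
pose psi (z : K (n + m)) : tens (K n) (K m) := \sum_(p <- s) p.1 ⊗ kmul e p.2 z.
have psiB : zmod_morphism psi.
  move=> x y; rewrite /psi -sumrB; apply: eq_bigr => p _.
  apply/eqP; rewrite eq_sym subr_eq -tmkDr; apply/eqP; congr (_ ⊗ _).
  by rewrite -kmulDr subrK.
exists psi => [u|z].
  elim/tens_ind: u => [x y|x y hx hy]; last by rewrite phi_is_additive psiB hx hy.
  (* The product of [p.2] and [x] has degree [0], so it crosses the tensor sign: [p.1 ⊗ (p.2 x) y]
     equals [p.1 (p.2 x) ⊗ y], and these sum to [x ⊗ y]. *)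
  rewrite /psi phiE -[in RHS](kmul1 (add0r n) x) -sE kmul_suml tmk_suml.
  apply: eq_bigr => p _.
  rewrite (kmulA (subrr n) (add0r n) (addNr n) (addr0 n)).
  by rewrite -(kmulA (addNr n) (add0r m) (erefl (n + m)) e) -tmk_mid.
have phi0 := zmod_morphism0 (@phi_is_additive n m).
have phiD := zmod_morphismD (@phi_is_additive n m).
rewrite /psi (big_morph _ phiD phi0) -[RHS](kmul1 (add0r _)) -sE kmul_suml.
by apply: eq_bigr => p _; rewrite phiE (kmulA (subrr n) (add0r (n + m)) e (erefl (n + m))).
Qed.

Lemma phi_isomorphism : bimodule_isomorphism (phi n m).
Proof.
have phiB := @phi_is_additive n m.
split; last exact: phi_bijective.
- move=> a u v; rewrite (zmod_morphismD phiB); congr (_ + _).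
  elim/tens_ind: u => [x y|x y hx hy]; last by rewrite scalerBr !phiB hx hy scalerBr.
  by rewrite scale_tmk !phiE; apply: kmulA.
- move=> u b; elim/tens_ind: u => [x y|x y hx hy].
    by rewrite ract_tmk !phiE; apply/esym/kmulA.
  have ractB (V : bimodType G G) (v w : V) : (v - w) <* b = v <* b - w <* b.
    by apply/eqP; rewrite eq_sym subr_eq -ractDl subrK.
  by rewrite ractB !phiB hx hy ractB.
Qed.

End Isomorphism.

(** * Invertibility through evaluation maps *)

Section Evaluation.
Variables (n m : int) (e : n + m = 0).

Section Module.
Variable M : lmodType G.

(** The map [w ⊗ (x ⊗ v) |-> (w x) v] is lifted one tensor sign at a time; here [w] is still
    fixed. *)
Definition kscale2 (w : K n) (t : tens (K m) M) : M :=
  tens_lift (fun x v => (kmul e w x : G) *: v) t.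

Fact kscale2_balanced w : balanced (fun (x : K m) (v : M) => (kmul e w x : G) *: v).
Proof.
split=> [x x' v|x v v'|x a v].
- by rewrite kmulDr scalerDl.
- by rewrite scalerDr.
- rewrite scalerA; congr (_ *: _).
  exact/esym/kmulA.
Qed.

Lemma kscale2E w x v : kscale2 w (x ⊗ v) = (kmul e w x : G) *: v.
Proof. exact: tens_liftE (kscale2_balanced w) x v. Qed.

Lemma kscale2B w : zmod_morphism (kscale2 w).
Proof. exact: tens_lift_is_additive (kscale2_balanced w). Qed.

Definition keval (u : tens (K n) (tens (K m) M)) : M := tens_lift kscale2 u.

Fact keval_balanced : balanced kscale2.
Proof.
split=> [w w' t|w|w a t].
- elim/tens_ind: t => [x v|t t' h h'].
    by rewrite !kscale2E kmulDl scalerDl.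
  by rewrite !kscale2B h h' opprD addrACA.
- exact/zmod_morphismD/kscale2B.
- elim/tens_ind: t => [x v|t t' h h'].
    rewrite scale_tmk !kscale2E; congr (_ *: _); exact: kmulA.
  by rewrite scalerBr !kscale2B h h'.
Qed.

Lemma kevalE w x v : keval (w ⊗ (x ⊗ v)) = (kmul e w x : G) *: v.
Proof. by rewrite /keval (tens_liftE keval_balanced) kscale2E. Qed.

Lemma kevalB : zmod_morphism keval.
Proof. exact: tens_lift_is_additive keval_balanced. Qed.

Lemma tens2_ext (H : zmodType) (f g : tens (K n) (tens (K m) M) -> H) :
  zmod_morphism f -> zmod_morphism g ->
  (forall w x v, f (w ⊗ (x ⊗ v)) = g (w ⊗ (x ⊗ v))) -> f =1 g.
Proof.
move=> fB gB fg; apply: tens_ext => // w.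
have tmkB : zmod_morphism (fun t : tens (K m) M => w ⊗ t).
  by move=> t t'; apply/eqP; rewrite eq_sym subr_eq -tmkDr subrK.
by apply: tens_ext => // t t'; rewrite tmkB ?fB ?gB.
Qed.

Lemma keval_linear : linear keval.
Proof.
move=> a u v; rewrite (zmod_morphismD kevalB); congr (_ + _); move: u.
apply: tens2_ext => [x y|x y|w x t]; rewrite ?scalerBr ?kevalB ?scalerBr //.
rewrite scale_tmk !kevalE scalerA; congr (_ *: _).
exact: kmulA.
Qed.

Lemma keval_bijective : splits_one e -> bijective keval.
Proof.
move=> [s sE]; pose g v := \sum_(p <- s) p.1 ⊗ (p.2 ⊗ v) : tens (K n) (tens (K m) M).
have gB : zmod_morphism g.
  move=> u v; apply/eqP; rewrite eq_sym subr_eq /g -big_split; apply/eqP/eq_bigr => p _ /=.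
  by rewrite -!tmkDr subrK.
exists g; last first.
  move=> v; rewrite /g (big_morph _ (zmod_morphismD kevalB) (zmod_morphism0 kevalB)).
  under eq_bigr => p _ do rewrite kevalE.
  by rewrite -scaler_suml; have -> := sE; apply: scale1r.
apply: (tens2_ext (f := g \o keval) (g := id)) => [x y|//|w x v] /=.
  by rewrite kevalB gB.
(* Write [w] as the sum of the [p.1 (p.2 w)]. First [p.2 w], then after reassociation [w x], has
   degree [0] and crosses a tensor sign, which turns [p.1 (p.2 w) ⊗ (x ⊗ v)] into
   [p.1 ⊗ (p.2 ⊗ (w x) v)]. *)
rewrite kevalE /g -[in RHS](kmul1 (add0r n) w) -sE kmul_suml tmk_suml.
apply: eq_bigr => p _.
have mn : m + n = 0 by rewrite addrC.
rewrite (kmulA e (add0r n) mn (addr0 n)) -[kmul (addr0 n) _ _]/(p.1 <* (kmul mn p.2 w : G)).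
rewrite tmk_mid scale_tmk -[_ *: x]/(kmul (add0r m) (kmul mn p.2 w) x).
rewrite (kmulA mn (add0r m) e (addr0 m)).
by rewrite -[kmul (addr0 m) _ _]/(p.2 <* (kmul e w x : G)) tmk_mid.
Qed.

End Module.

Lemma tens_functors_isomorphic : splits_one e ->
  nat_isomorphic (comp_functor (tens_functor (K n)) (tens_functor (K m)))
    (id_functor G).
Proof.
move=> se; exists (fun M => linear_of (@keval_linear M)); split=> [M|M N f].
  exact: keval_bijective.
change (@keval N \o tens_map (K n) (tens_map (K m) f) =1 f \o @keval M).
apply: tens2_ext.
- by move=> x y /=; rewrite raddfB kevalB.
- by move=> x y /=; rewrite kevalB raddfB.
by move=> w x v; rewrite /= tens_mapE /= tens_mapE !kevalE linearZ.
Qed.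

End Evaluation.

Lemma K_invertible n (e : n + - n = 0) (e' : - n + n = 0) :
  splits_one e -> splits_one e' -> invertible_bimodule (K n).
Proof.
by move=> se se'; exists (tens_functor (K (- n))); split;
  [apply: tens_functors_isomorphic se' | apply: tens_functors_isomorphic se].
Qed.

End StronglyGraded.

(** * Algebras with radical square zero *)

Section AlgebraModule.
Variables (R : comPzRingType) (A : pzRingType) (iota : algebra_on R A).

(** The phantom argument lets the [R]-module instance on [A] depend on the structure map. *)
Definition alg_mod of algebra_on R A : Type := A.
HB.instance Definition _ := GRing.Zmodule.on (alg_mod iota).

Definition alg_scale (c : R) (x : alg_mod iota) : alg_mod iota := iota c * (x : A).

Fact alg_scaleA a b x : alg_scale a (alg_scale b x) = alg_scale (a * b) x.
Proof. by rewrite /alg_scale mulrA rmorphM. Qed.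
Fact alg_scale1 : left_id 1 alg_scale.
Proof. by move=> x; rewrite /alg_scale rmorph1 mul1r. Qed.
Fact alg_scaleDr : right_distributive alg_scale +%R.
Proof. by move=> a x y; apply: (mulrDr (iota a) (x : A)). Qed.
Fact alg_scaleDl x : {morph alg_scale^~ x : a b / a + b}.
Proof. by move=> a b; rewrite /alg_scale rmorphD; apply: mulrDl. Qed.
HB.instance Definition _ := GRing.Zmodule_isLmodule.Build R (alg_mod iota)
  alg_scaleA alg_scale1 alg_scaleDr alg_scaleDl.

Lemma artinian_alg_mod : artin_algebra iota -> artinian_mod (alg_mod iota).
Proof.
move=> [dcc [k [g gP]]].
apply: (artinian_mod_fg (s := [seq (g i : alg_mod iota) | i <- enum 'I_k])) dcc _ => x.
have [c ->] := gP x; rewrite -big_enum /=.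
elim: (enum 'I_k) => [|i s ih]; first by rewrite big_nil.
by exists (c i); rewrite big_cons addrAC subrr add0r.
Qed.

End AlgebraModule.

Section RadSquareZero.
Variables (R : comPzRingType) (A : pzRingType) (iota : algebra_on R A).
Hypothesis hA : artin_algebra iota.

Lemma jpiM_ring (x y : A) : jpi (x * y) = jpi x * jpi y.
Proof. by rewrite -jpiM. Qed.

(** Preimages under [jpi] of left ideals are [R]-submodules of [A], and inclusion is reflected
    because [jpi] is onto. *)
Lemma artinian_jquot : artinian_mod ((jquot A)^o : lmodType (jquot A)).
Proof.
apply: (artinian_mod_transfer (V := alg_mod iota) (W := (jquot A)^o)
  (F := fun I (x : A) => I (jpi x))) (artinian_alg_mod hA) => [I [I0 ID IM]|I J IJ x|I J IJ x].
- split=> [|x y Ix Iy|c x Ix].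
  + have -> : jpi (0 : A) = 0 by apply: raddf0.
    exact: I0.
  + by rewrite jpiD; apply: ID.
  + by rewrite jpiM_ring; apply: IM.
- exact: IJ.
- by rewrite -[x]jrepK; apply: IJ.
Qed.

(** A representative [x] lies in every maximal left ideal [I]: otherwise [1 = u + b x] with [u] in
    [I], and [1 = (1 + b x) u + (b x)^2] would lie in [I], since the square is in the radical. *)
Lemma semiprime_jquot (a : jquot A) : (forall b, b * a * (b * a) = 0) -> a = 0.
Proof.
rewrite -[a]jrepK; set x := jrep a => h.
have -> : 0 = jpi (0 : A) by apply/esym/raddf0.
apply/jpi_eq; rewrite subr0; apply/asboolP => I Imax; have [II I1 Itop] := Imax.
have [I0 ID IM] := II; apply: contrapT => nIx.
pose J z := exists2 u, I u & exists b, z = u + b * x.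
have JI : left_ideal J.
  split=> [|_ _ [u Iu [b ->]] [v Iv [c ->]]|c _ [u Iu [b ->]]].
  - by exists 0 => //; exists 0; rewrite mul0r addr0.
  - by exists (u + v); [exact: ID | exists (b + c); rewrite mulrDl addrACA].
  - by exists (c * u); [exact: IM | exists (c * b); rewrite mulrDr mulrA].
case: (Itop J JI) => [u Iu|JsubI|[u Iu [b e1]]].
- by exists u => //; exists 0; rewrite mul0r addr0.
- by apply/nIx/JsubI; exists 0 => //; exists 1; rewrite mul1r add0r.
have bx2 : I (b * x * (b * x)).
  have : b * x * (b * x) \in @jacobson A.
    rewrite -[b * x * (b * x)]subr0; apply/jpi_eq; rewrite !jpiM_ring h.
    exact/esym/raddf0.
  by move/asboolP; apply.
have eu : u = 1 - b * x by rewrite e1 addrK.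
apply: I1; have -> : 1 = (1 + b * x) * u + b * x * (b * x).
  by rewrite eu mulrBr mulr1 mulrDl mul1r opprD addrA addrK subrK.
by apply: ID => //; apply: IM.
Qed.

Variable hr : rad_square_zero A.

(** Submodules of the radical over [A/r] are [R]-submodules of [A], as [c] in [R] acts on the
    radical through the class of [iota c]. *)
Lemma artinian_rad : artinian_mod (rad_bimod hr).
Proof.
apply: (artinian_mod_transfer (V := alg_mod iota) (W := rad_bimod hr)
  (F := fun N (a : A) => exists2 x : rad_bimod hr, rad_val x = a & N x))
  (artinian_alg_mod hA) => [N [N0 ND NZ]|N N' NN' _ [x <- Nx]|N N' NN' x Nx].
- split=> [|_ _ [x <- Nx] [y <- Ny]|c _ [x <- Nx]].
  + by exists 0.
  + by exists (x + y); last exact: ND.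
  + by exists (jpi (iota c) *: x); [exact: rad_scaleE | exact: NZ].
- by exists x => //; apply: NN'.
- have [y yx N'y] := NN' (rad_val x) (ex_intro2 _ _ x erefl Nx).
  by have <- : y = x := @val_inj _ _ (Defs.rad A) y x yx.
Qed.

Lemma generates_rad : generates (jquot A)^o (rad_bimod hr).
Proof.
apply: generates_artinian artinian_rad => I.
exact: left_ideal_idempotent artinian_jquot semiprime_jquot I.
Qed.

Lemma splits_one_rad (n m : int) (e : n + m = 0) : splits_one (rad_bimod hr) e.
Proof.
have [i hi] := generates_tpow_pred artinian_jquot generates_rad.
apply: (splits_one_all (h1 := subrr 1) (h2 := addNr 1)) e.
  (* Degree [1] uses the stage [i] at which the trace ideals have become stationary; degree [-1]
     comes from [generates_tpowS], which holds at every stage. *)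
  apply: (generates_splits_one (i := i.+1) (j := i)) => //.
  by rewrite intS addrK.
apply: (generates_splits_one (i := i) (j := i.+1)); last exact/generates_tpowS/generates_rad.
by rewrite intS opprD addrC subrK.
Qed.

End RadSquareZero.

Theorem theoremA (R : comPzRingType) (A : pzRingType) (iota : algebra_on R A)
    (hA : artin_algebra iota) (hr : rad_square_zero A) :
  (forall n : int, invertible_bimodule (K (rad_bimod hr) n)) /\
  (forall n m : int, bimodule_isomorphism (phi (rad_bimod hr) n m)).
Proof.
split=> n.
  by apply: (K_invertible (e := subrr n) (e' := addNr n)); exact: (splits_one_rad hA).
by move=> m; apply: phi_isomorphism; exact: (splits_one_rad hA).
Qed.
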